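(* Let $\{u_n\}_{n\in\mathbb N}$ be a bounded sequence in $H^s(\mathbb R^N)$ with $\int_{\mathbb R^N}|u_n|^2\to\lambda$ as $n\to+\infty$. Then there exists a subsequence $\{n_k\}_{k\in\mathbb N}$ such that one of the following three cases occurs: (i) Compactness: there exists $\{y_k\}_{k\in\mathbb N}\subset\mathbb R^N$ such that $$\forall\varepsilon>0,\ \exists R<+\infty\ \text{ such that }\ \int_{y_k+B_R}|u_{n_k}|^2\ge\lambda-\varepsilon.$$ (ii) Vanishing: $\lim_{k\to+\infty}\sup_{y\in\mathbb R^N}\int_{y+B_R}|u_{n_k}|^2=0$ for every $R>0$. (iii) Dichotomy: there exists $\alpha\in(0,\lambda)$ such that, for all $\varepsilon>0$, there exist $k_0\in\mathbb N$ and $\{v_k\}_{k\in\mathbb N},\{w_k\}_{k\in\mathbb N}\subset H^s(\mathbb R^N)$ such that, for $k\ge k_0$: $$\|u_{n_k}-v_k-w_k\|_{L^2(\mathbb R^N)}\le\delta(\varepsilon)\to0\quad\text{for }\varepsilon\to0;$$ $$\Big|\int_{\mathbb R^N}|v_k|^2-\alpha\Big|\le\varepsilon,\qquad \Big|\int_{\mathbb R^N}|w_k|^2-(\lambda-\alpha)\Big|\le\varepsilon;$$ $$\operatorname{dist}(\operatorname{supp}v_k,\operatorname{supp}w_k)\to+\infty\quad\text{for }k\to+\infty;$$ $$[u_{n_k}]_{H^s(\mathbb R^N)}^2-[v_k]_{H^s(\mathbb R^N)}^2-[w_k]_{H^s(\mathbb R^N)}^2\ge-2\varepsilon.$$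
   Context: Here $s\in(0,1)$ is fixed and $N\ge1$ is the dimension. $H^s(\mathbb R^N)=\{u\in L^2(\mathbb R^N): [u]_{H^s(\mathbb R^N)}<+\infty\}$, where $[u]_{H^s(\mathbb R^N)}^2=\int_{\mathbb R^N}\int_{\mathbb R^N}\frac{|u(x)-u(y)|^2}{|x-y|^{N+2s}}\,dx\,dy$, with norm $\|u\|_{H^s(\mathbb R^N)}^2=\|u\|_{L^2(\mathbb R^N)}^2+[u]_{H^s(\mathbb R^N)}^2$. $B_R$ denotes the ball of radius $R$ centered at the origin. In case (iii), $\delta(\varepsilon)$ is a quantity depending on $\varepsilon$ that tends to $0$ as $\varepsilon\to0$.
   Formalization: In case (i) the bound is stated for all sufficiently large k (depending on ε, with R independent of k), since for all k it fails when the masses are below λ, e.g. u_n=(1-1/n)u. *)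

(* Defs.v *)
From HB Require Import structures.
From mathcomp Require Import all_boot all_order all_algebra.
From mathcomp Require Import all_classical all_reals all_analysis.

Set Implicit Arguments.
Unset Strict Implicit.
Unset Printing Implicit Defensive.
Import Order.TTheory GRing.Theory Num.Theory.
Import numFieldNormedType.Exports.

Local Open Scope classical_set_scope.
Local Open Scope ring_scope.

(* The space R^n is 'rV[R]_n.  Its sigma-algebra is the product one, generated
   by the coordinates; as R^n is second countable, these are the Borel sets. *)
Section measurable_rV.
Context (R : realType) (n : nat).

Let coord : 'I_n -> 'rV[R]_n -> R := fun i v => v ord0 i.

Let rV_set0 : g_sigma_preimage coord set0.
Proof. exact: sigma_algebra0. Qed.

Let rV_setC A : g_sigma_preimage coord A -> g_sigma_preimage coord (~` A).
Proof. exact: sigma_algebraC. Qed.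

Let rV_bigcup (F : (set 'rV[R]_n)^nat) :
  (forall i, g_sigma_preimage coord (F i)) ->
  g_sigma_preimage coord (\bigcup_i F i).
Proof. exact: sigma_algebra_bigcup. Qed.

HB.instance Definition _ := @isMeasurable.Build default_measure_display
  'rV[R]_n (g_sigma_preimage coord) rV_set0 rV_setC rV_bigcup.

Lemma measurable_coord (i : 'I_n) :
  measurable_fun [set: 'rV[R]_n] (fun v : 'rV[R]_n => v ord0 i).
Proof.
move=> _ Y mY; rewrite setTI; apply: sub_sigma_algebra => /=.
rewrite -bigcup_seq/=; exists i => /=; first by rewrite mem_index_enum.
by exists Y => //; rewrite setTI.
Qed.

Lemma measurable_fun_coordP d (T : measurableType d) (f : T -> 'rV[R]_n) :
  (forall i, measurable_fun [set: T] (fun x => f x ord0 i)) ->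
  measurable_fun [set: T] f.
Proof.
move=> mf _ A mA; rewrite setTI.
have : preimage_set_system setT f measurable `<=` (@measurable _ T).
  have <- : g_sigma_preimage (fun i => coord i \o f) =
            preimage_set_system setT f (g_sigma_preimage coord).
    exact: (g_sigma_preimage_comp coord f).
  apply: smallest_sub; first exact: sigma_algebra_measurable.
  rewrite -bigcup_seq => B [i _ [C mC <-]]; exact: mf.
by apply; exists A => //; rewrite setTI.
Qed.

End measurable_rV.

Section lebesgue_measure_rV.
Context (R : realType).

Definition cons_rV n (p : measurableTypeR R * 'rV[R]_n) : 'rV[R]_n.+1 :=
  \row_i if unlift ord0 i is Some j then p.2 ord0 j else p.1.

Lemma cons_rV0 n p : @cons_rV n p ord0 ord0 = p.1.
Proof. by rewrite mxE unlift_none. Qed.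

Lemma cons_rV_lift n p i : @cons_rV n p ord0 (lift ord0 i) = p.2 ord0 i.
Proof. by rewrite mxE liftK. Qed.

Lemma measurable_cons_rV n : measurable_fun setT (@cons_rV n).
Proof.
apply: measurable_fun_coordP => i.
case: (unliftP ord0 i) => [j|] ->.
  rewrite (_ : (fun x => _) = (fun v : 'rV[R]_n => v ord0 j) \o snd); last first.
    by apply/funext => p /=; exact: cons_rV_lift.
  exact: measurableT_comp (@measurable_coord R n j) measurable_snd.
rewrite (_ : (fun x => _) = fst); last by apply/funext => p; exact: cons_rV0.
exact: (@measurable_fst _ _ (measurableTypeR R) 'rV[R]_n).
Qed.

Section step.
Context (n : nat) (m : {sigma_finite_measure set 'rV[R]_n -> \bar R}).

Definition lebesgue_rV_step : set 'rV[R]_n.+1 -> \bar R :=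
  pushforward (lebesgue_measure \x m)%E (@cons_rV n).

Let step0 : lebesgue_rV_step set0 = 0%E.
Proof. by rewrite /lebesgue_rV_step /pushforward preimage_set0 measure0. Qed.

Let step_ge0 A : (0 <= lebesgue_rV_step A)%E.
Proof. by rewrite /lebesgue_rV_step /pushforward measure_ge0. Qed.

Let step_additive : semi_sigma_additive lebesgue_rV_step.
Proof.
have mc (A : set 'rV[R]_n.+1) : measurable A -> measurable (@cons_rV n @^-1` A).
  by move=> mA; rewrite -[X in measurable X]setTI; exact: measurable_cons_rV.
move=> F mF tF mUF; rewrite /lebesgue_rV_step /pushforward preimage_bigcup.
apply: measure_semi_sigma_additive.
- by move=> k; exact: mc.
- apply/trivIsetP => /= i j _ _ ij; rewrite -preimage_setI.
  by move/trivIsetP : tF => /(_ _ _ _ _ ij) ->//; rewrite preimage_set0.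
- by rewrite -preimage_bigcup; exact: mc.
Qed.

HB.instance Definition _ :=
  isMeasure.Build _ _ _ lebesgue_rV_step step0 step_ge0 step_additive.

Let step_sigma_finite : sigma_finite setT lebesgue_rV_step.
Proof.
pose uncons (v : 'rV[R]_n.+1) : measurableTypeR R * 'rV[R]_n :=
  (v ord0 ord0, \row_i v ord0 (lift ord0 i)).
have uncons_meas : measurable_fun setT uncons.
  apply: (@measurable_fun_pair _ _ _ _ (measurableTypeR R)).
    exact: (@measurable_coord R n.+1 ord0).
  apply: measurable_fun_coordP => i.
  rewrite (_ : (fun x => _) = fun v : 'rV[R]_n.+1 => v ord0 (lift ord0 i)).
    exact: measurable_coord.
  by apply/funext => v; rewrite mxE.
have consK : cancel (@cons_rV n) uncons.
  move=> [x v]; rewrite /uncons cons_rV0; congr pair.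
  by apply/rowP => i; rewrite mxE cons_rV_lift.
have [F TF mF] : sigma_finite setT (lebesgue_measure \x m)%E.
  have /sigma_finiteP[G [TG ndG mG]] :=
    sigma_finiteT (@lebesgue_measure R : {sigma_finite_measure set _ -> \bar R}).
  have /sigma_finiteP[H [TH ndH mH]] := sigma_finiteT m.
  exists (fun k => G k `*` H k).
    rewrite -setXTT TG TH predeqE => -[x y]; split.
      move=> [/= [i _ Gix] [j _ Hjy]]; exists (maxn i j) => //; split.
      - by move: x Gix; exact/subsetPset/ndG/leq_maxl.
      - by move: y Hjy; exact/subsetPset/ndH/leq_maxr.
    by move=> [i _ []/= ? ?]; split; exists i.
  move=> k; have [? ?] := mG k; have [? ?] := mH k.
  split; first exact: measurableX.
  by rewrite product_measure1E// lte_mul_pinfty// ge0_fin_numE.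
exists (fun k => uncons @^-1` F k).
  by rewrite -preimage_bigcup -TF preimage_setT.
move=> k; have [mFk Fk] := mF k; split.
  by rewrite -[X in measurable X]setTI; exact: uncons_meas.
rewrite /lebesgue_rV_step /pushforward (_ : _ @^-1` _ = F k)//.
by apply/seteqP; split => p /=; rewrite consK.
Qed.

HB.instance Definition _ :=
  Measure_isSigmaFinite.Build _ _ _ lebesgue_rV_step step_sigma_finite.

End step.

(* Lebesgue measure on R^n, as the n-fold product of the one on R. *)
Fixpoint lebesgue_rV n : {sigma_finite_measure set 'rV[R]_n -> \bar R} :=
  if n is n'.+1 then lebesgue_rV_step (lebesgue_rV n') else \d_(0 : 'rV[R]_0).

Lemma lebesgue_rV_box n (A : 'I_n -> set R) : (forall i, measurable (A i)) ->
  lebesgue_rV n [set v : 'rV[R]_n | forall i, A i (v ord0 i)] =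
  (\prod_(i < n) lebesgue_measure (A i))%E.
Proof.
elim: n A => [|n IHn] A mA.
  have -> : [set v : 'rV[R]_0 | forall i, A i (v ord0 i)] = setT.
    by apply/seteqP; split => // v _ [].
  by rewrite big_ord0 /= diracT.
rewrite big_ord_recl -IHn//= /lebesgue_rV_step /pushforward.
rewrite -(@product_measure1E _ _ (measurableTypeR R) 'rV[R]_n)//.
- have -> // : (@cons_rV n) @^-1` [set v : 'rV[R]_n.+1 | forall i, A i (v ord0 i)] =
    A ord0 `*` [set v : 'rV[R]_n | forall i, A (lift ord0 i) (v ord0 i)].
  apply/seteqP; split => [[x v] /= Av|[x v] /= [Ax Av] i].
    by split => [|i]; [have := Av ord0; rewrite cons_rV0|
                       have := Av (lift ord0 i); rewrite cons_rV_lift].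
  by case: (unliftP ord0 i) => [j|] ->; rewrite ?cons_rV0 ?cons_rV_lift.
- exact: mA.
- rewrite (_ : [set v : 'rV[R]_n | _] =
    \bigcap_(i in [set: 'I_n]) [set v : 'rV[R]_n | A (lift ord0 i) (v ord0 i)]).
    apply: fin_bigcap_measurable => // i _.
    rewrite -[X in measurable X]setTI; exact: measurable_coord.
  by apply/seteqP; split => [v Av i _|v Av i]; [exact: Av|exact: Av i I].
Qed.

End lebesgue_measure_rV.

Section fractional_sobolev.
Context (R : realType) (N : nat).
Local Open Scope ereal_scope.

Notation mu := (lebesgue_rV R N).
Implicit Types (u v : 'rV[R]_N -> R) (x y : 'rV[R]_N).

(* The library norm on 'rV[R]_N is the sup norm. *)
Definition enorm x : R := Num.sqrt (\sum_(i < N) (x ord0 i) ^+ 2).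

Definition eball y (r : R) : set 'rV[R]_N := [set x | (enorm (x - y) < r)%R].

(* The squared seminorm [u]^2.  On the null set x = y the integrand is 0, by
   the conventions 0 `^ a = 0 (a <> 0) and 0^-1 = 0. *)
Definition gagliardo2 (s : R) u : \bar R :=
  \int[mu]_x \int[mu]_y
    (`|u x - u y| ^+ 2 / enorm (x - y) `^ (N%:R + 2 * s))%:E.

(* Functions rather than a.e. classes; every class has a Borel representative. *)
Definition Hs (s : R) : set ('rV[R]_N -> R) :=
  [set u | u \in Lfun mu 2%:E /\ gagliardo2 s u < +oo].

Definition Hs_norm (s : R) u : \bar R :=
  sqrte ('N[mu]_2%:E[EFin \o u] ^+ 2 + gagliardo2 s u).

(* Support of an element of L^2, invariant under a.e. modification: the
   complement of the largest open set on which u vanishes a.e. *)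
Definition supp u : set 'rV[R]_N :=
  ~` \bigcup_(U in [set U | open U /\ {ae mu, forall x, U x -> u x = 0%R}]) U.

(* +oo when A or B is empty *)
Definition set_dist (A B : set 'rV[R]_N) : \bar R :=
  ereal_inf [set (enorm (x - y))%:E | x in A & y in B].

(* The bound is for large k only: lambda is the limit of the masses, so it can
   exceed the mass of the first terms. *)
Definition compactness (u : ('rV[R]_N -> R)^nat) (lambda : R) :=
  exists y : ('rV[R]_N)^nat, forall eps : R, (0 < eps)%R ->
    exists2 r : R, (0 < r)%R &
      \forall k \near \oo,
        (lambda - eps)%:E <= \int[mu]_(x in eball (y k) r) (`|u k x| ^+ 2)%:E.

Definition vanishing (u : ('rV[R]_N -> R)^nat) :=
  forall r : R, (0 < r)%R ->
    ereal_sup [set \int[mu]_(x in eball y r) (`|u k x| ^+ 2)%:E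
              | y in [set: 'rV[R]_N]] @[k --> \oo] --> 0.

Definition dichotomy (s : R) (u : ('rV[R]_N -> R)^nat) (lambda : R) :=
  exists2 alpha : R, (0 < alpha < lambda)%R &
  exists2 delta : R -> R, delta e @[e --> 0^'+] --> 0%R &
  forall eps : R, (0 < eps)%R ->
  exists (k0 : nat) (v w : ('rV[R]_N -> R)^nat),
    [/\ forall k, Hs s (v k) /\ Hs s (w k),
        set_dist (supp (v k)) (supp (w k)) @[k --> \oo] --> +oo &
        forall k, (k0 <= k)%N ->
        [/\ 'N[mu]_2%:E[EFin \o (u k \- v k \- w k)%R] <= (delta eps)%:E,
            `|\int[mu]_x (`|v k x| ^+ 2)%:E - alpha%:E| <= eps%:E,
            `|\int[mu]_x (`|w k x| ^+ 2)%:E - (lambda - alpha)%:E| <= eps%:E &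
            (- 2 * eps)%:E <=
              gagliardo2 s (u k) - gagliardo2 s (v k) - gagliardo2 s (w k)]].

End fractional_sobolev.

(* Main.v *)
Require Import Defs.
From mathcomp Require Import all_boot all_order all_algebra.
From mathcomp Require Import all_classical all_reals all_analysis.
From mathcomp Require Import measurable_realfun ring lra.
Import Order.TTheory GRing.Theory Num.Theory.
Import numFieldNormedType.Exports.
Local Open Scope classical_set_scope.
Local Open Scope ring_scope.

Set Implicit Arguments.
Unset Strict Implicit.
Unset Printing Implicit Defensive.

(** Lions' argument with Levy's concentration function
    Q_k(r) = sup_y int_{y + B_r} |u_k|^2. Along a subsequence Q_k(m) converges to
    some q(m) for every natural radius m, uniformly enough that
    Q_k(k + 1) <= q(k + 1) + o(1). Put alpha = sup_m q(m), which lies in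
    [0, lambda]. If alpha = 0 the sequence vanishes. If alpha = lambda, balls
    carrying more than half of the mass must meet balls carrying almost all of
    it, so both can be centered at the same points. Otherwise almost alpha of the
    mass lies in y_k + B_{r_1} with r_1 fixed, whereas y_k + B_{k+1} carries
    hardly more; one splits u_k by a radial cutoff phi at scale r_1 and the
    complement psi of a cutoff at scale (k + 1)/2. The cutoffs have disjoint
    supports, so phi^2 + psi^2 <= 1, and Young's inequality bounds
    [phi u]^2 + [psi u]^2 by (1 + eta) [u]^2 plus a multiple of
    (1 + 1/eta) r_1^(-2s) |u|_2^2, the power of r_1 coming from
    int min(1, |z|/r_1)^2 |z|^(-N-2s) dz = O(r_1^(-2s)). *)

(** * Euclidean norm, balls and cubes in R^N *)

Section euclidean_norm.
Context (R : realType) (N : nat).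
Implicit Types (x y z : 'rV[R]_N).

Lemma enorm_ge0 x : 0 <= enorm x.
Proof. exact: sqrtr_ge0. Qed.

Lemma sqr_enorm x : enorm x ^+ 2 = \sum_(i < N) x ord0 i ^+ 2.
Proof. by rewrite sqr_sqrtr// sumr_ge0// => i _; exact: sqr_ge0. Qed.

Lemma enormN x : enorm (- x) = enorm x.
Proof. by congr Num.sqrt; apply: eq_bigr => i _; rewrite mxE sqrrN. Qed.

Lemma enorm_distC x y : enorm (x - y) = enorm (y - x).
Proof. by rewrite -opprB enormN. Qed.

Lemma normr_coord_le_enorm x i : `|x ord0 i| <= enorm x.
Proof.
rewrite -(@ler_pXn2r _ 2)// ?nnegrE ?enorm_ge0//.
rewrite sqr_enorm real_normK ?num_real// (bigD1 i)//= lerDl.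
by rewrite sumr_ge0// => j _; exact: sqr_ge0.
Qed.

Lemma enorm_eq0 x : enorm x = 0 -> x = 0.
Proof.
move=> x0; apply/rowP => i; rewrite mxE; apply/eqP.
by rewrite -normr_le0 -x0 normr_coord_le_enorm.
Qed.

Lemma ler_enormD x y : enorm (x + y) <= enorm x + enorm y.
Proof.
have [/enorm_eq0 ->|x0] := eqVneq (enorm x) 0.
  by rewrite add0r lerDr enorm_ge0.
have [/enorm_eq0 ->|y0] := eqVneq (enorm y) 0.
  by rewrite addr0 lerDl enorm_ge0.
have a0 : 0 < enorm x by rewrite lt_def x0 enorm_ge0.
have b0 : 0 < enorm y by rewrite lt_def y0 enorm_ge0.
rewrite -(@ler_pXn2r _ 2)// ?nnegrE ?addr_ge0 ?enorm_ge0//.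
rewrite sqr_enorm; set a := enorm x in a0 *; set b := enorm y in b0 *.
pose t := b / a; have t0 : 0 < t by rewrite divr_gt0.
(* the weight t = |y|/|x| makes Young's inequality sharp for the norms *)
apply: (@le_trans _ _
    (\sum_(i < N) ((1 + t) * x ord0 i ^+ 2 + (1 + t^-1) * y ord0 i ^+ 2))).
  apply: ler_sum => i _; rewrite mxE -subr_ge0.
  rewrite (_ : _ - _ = (t * x ord0 i - y ord0 i) ^+ 2 / t).
    by rewrite divr_ge0 ?sqr_ge0// ltW.
  by field; rewrite gt_eqF.
rewrite big_split/= -!mulr_sumr -!sqr_enorm -/a -/b.
rewrite le_eqVlt; apply/orP; left; apply/eqP; rewrite /t; field.
by rewrite !gt_eqF.
Qed.

Lemma ler_dist_enorm x y : `|enorm x - enorm y| <= enorm (x - y).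
Proof.
rewrite ler_norml; apply/andP; split.
  rewrite lerNl opprB lerBlDr enorm_distC.
  by rewrite -{1}(subrK x y); exact: ler_enormD.
by rewrite lerBlDr -{1}(subrK y x); exact: ler_enormD.
Qed.

Lemma continuous_enorm : continuous (@enorm R N).
Proof.
have cS : continuous (fun v : 'rV[R]_N => \sum_(i < N) v ord0 i ^+ 2 : R).
  have := @continuous_big R 'I_N +%R 0 xpredT (@add_continuous R) 'rV[R]_N
    (index_enum _) (fun i v => v ord0 i ^+ 2). apply=> i _ v.
  apply: (@continuous_comp _ _ _ (fun v : 'rV[R]_N => v ord0 i)
    (fun r : R => r ^+ 2)); first exact: coord_continuous.
  exact: exprn_continuous.
by move=> x; apply: continuous_comp; [exact: cS|exact: sqrt_continuous].
Qed.

(** The source is arbitrary so that both the translates [x - y] and the difference map on pairs are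
    covered. *)
Lemma measurable_enorm_fun d (T : measurableType d) (f : T -> 'rV[R]_N) :
  (forall i, measurable_fun setT (fun t => f t ord0 i)) ->
  measurable_fun setT (fun t => enorm (f t)).
Proof.
move=> mf; apply: (@measurableT_comp _ _ _ _ _ _ (@Num.sqrt R)).
  by apply: continuous_measurable_fun; exact: sqrt_continuous.
by apply: measurable_sum => i; exact: measurable_funX.
Qed.

Lemma measurable_enormB y : measurable_fun setT (fun x => enorm (x - y)).
Proof.
apply: measurable_enorm_fun => i.
under eq_fun do rewrite !mxE; apply: measurable_funD => //.
exact: measurable_coord.
Qed.

Lemma measurable_eball y r : measurable (eball y r).
Proof.
rewrite (_ : eball y r = (fun x => enorm (x - y)) @^-1` `]-oo, r[).
  by rewrite -[X in measurable X]setTI; apply: measurable_enormB.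
by apply/seteqP; split => x /=; rewrite in_itv.
Qed.

Lemma eball_subset y z r r' : enorm (y - z) + r <= r' -> eball y r `<=` eball z r'.
Proof.
move=> yzr x; rewrite /eball/= => xyr; apply: lt_le_trans yzr.
rewrite (_ : x - z = (y - z) + (x - y)); last by rewrite [RHS]addrC addrA subrK.
by apply: le_lt_trans (ler_enormD _ _) _; rewrite ltrD2l.
Qed.

(** Sup-norm balls replace Euclidean balls in the kernel estimate: an upper bound for volumes
    suffices there, and the product measure gives the volume of a cube exactly. *)
Definition cube y r : set 'rV[R]_N := [set x | forall i, `]y ord0 i - r, y ord0 i + r[%classic (x ord0 i)].

Lemma measurable_cube y r : measurable (cube y r).
Proof.
rewrite (_ : cube y r = \bigcap_(i in [set: 'I_N])
    ((fun v : 'rV[R]_N => v ord0 i) @^-1` `]y ord0 i - r, y ord0 i + r[)).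
  apply: fin_bigcap_measurable => // i _.
  by rewrite -[X in measurable X]setTI; apply: measurable_coord.
by apply/seteqP; split => [x xy i _|x xy i]; [exact: xy|exact: xy i I].
Qed.

Lemma eball_cube y r : eball y r `<=` cube y r.
Proof.
move=> x; rewrite /eball /cube /= => xyr i.
have := le_lt_trans (normr_coord_le_enorm (x - y) i) xyr.
by rewrite !mxE in_itv/= ltr_norml ltrBrDl => /andP[-> ?]; rewrite -ltrBlDl.
Qed.

Lemma lebesgue_rV_cube y r : 0 <= r -> lebesgue_rV R N (cube y r) = ((2 * r) ^+ N)%:E.
Proof.
move=> r0; have := @lebesgue_rV_box R N
  (fun i => `]y ord0 i - r, y ord0 i + r[%classic) (fun=> measurable_itv _).
rewrite -/(cube y r) => ->.
under eq_bigr => i _.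
  rewrite lebesgue_measure_itv/= lte_fin -EFinD.
  rewrite (_ : (if _ then _ else _) = (2 * r)%:E); last first.
    case: ifPn => [_|]; first by congr EFin; ring.
    rewrite -leNgt => ?; have -> : r = 0 by lra.
    by rewrite mulr0.
  over.
by rewrite prodEFin prodr_const card_ord.
Qed.

End euclidean_norm.

(** * Integral of the truncated singular kernel *)

Section kernel.
Context (R : realType) (N : nat).
Implicit Types (x y : 'rV[R]_N).
Local Notation mu := (lebesgue_rV R N).

(** The least n with x < 2^n is not 0 because x >= 1; its predecessor is the exponent sought. *)
Lemma dyadic_bracket (x : R) : 1 <= x -> exists i : nat, 2 ^+ i <= x < 2 ^+ i.+1.
Proof.
move=> x1; have : exists n : nat, x < 2 ^+ n.
  exists (Num.bound x); apply: (lt_le_trans (archi_boundP _)); first lra.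
  by rewrite -natrX ler_nat ltnW// ltn_expl.
case/ex_minnP => -[|n] xn nmin; first by move: xn; rewrite expr0; lra.
exists n; rewrite xn andbT leNgt; apply/negP => /nmin.
by rewrite ltnn.
Qed.

Lemma nneseries_geometric (a t : R) : 0 <= t < 1 ->
  (\sum_(0 <= i <oo) (a * t ^+ i)%:E)%E = (a / (1 - t))%:E.
Proof.
move=> /andP[t0 t1]; apply/cvg_lim => //.
under eq_fun do rewrite sumEFin.
apply: cvg_EFin; first exact: nearW.
by apply: cvg_geometric_series; rewrite ger0_norm.
Qed.

(** Termwise integration: the weights balance the volumes of the cubes, which leaves a geometric
    series. *)
Lemma integral_geometric_cubes x (c rho : nat -> R) (a t : R) :
  (forall i, 0 <= c i) -> (forall i, 0 <= rho i) -> 0 <= t < 1 ->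
  (forall i, c i * (2 * rho i) ^+ N = a * t ^+ i) ->
  (\int[mu]_y \sum_(0 <= i <oo) (c i * \1_(cube x (rho i)) y)%:E)%E =
  (a / (1 - t))%:E.
Proof.
move=> c0 rho0 t01 crho; rewrite integral_nneseries//; last 2 first.
- move=> i; apply/measurable_EFinP; apply: measurable_funM => //.
  by apply: measurable_indic; exact: measurable_cube.
- by move=> i y _; rewrite lee_fin mulr_ge0.
rewrite -(nneseries_geometric a t01); apply: eq_eseriesr => i _.
under eq_integral do rewrite EFinM.
rewrite ge0_integralZl_EFin//; last first.
  by apply/measurable_EFinP; apply: measurable_indic; exact: measurable_cube.
rewrite integral_indic//; last exact: measurable_cube.
by rewrite setIT [X in (_ * X)%E](lebesgue_rV_cube x (rho0 i)) -EFinM crho.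
Qed.

Lemma nneseries_term_le (f : nat -> \bar R) n : (forall i, 0 <= f i)%E ->
  (f n <= \sum_(0 <= i <oo) f i)%E.
Proof.
move=> f0; apply: (@le_trans _ _ (\sum_(0 <= i < n.+1) f i)%E).
  by rewrite big_nat_recr//= leeDr// sume_ge0.
exact: nneseries_lim_ge.
Qed.

Lemma powR2_lt1 (p : R) : p < 0 -> 0 <= (2 : R) `^ p < 1.
Proof.
move=> p0; have : (2 : R) `^ p <= 2 `^ 0.
  by apply: ler_powR; [rewrite ler1n|exact: ltW].
have n1 : (2 : R) != 1 by rewrite gt_eqF// ltr1n.
have n2 : ((2 : R) < 0) = false by rewrite ltNge ler0n.
by rewrite powRr0 powR_ge0 lt_neqAle powR_eq1 (negbTE n1) n2 (lt_eqF p0) => ->.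
Qed.

Lemma measurable_truncated_kernel (r p : R) x : measurable_fun setT
  (fun y => (Num.min 1 (enorm (x - y) / r) ^+ 2 / enorm (x - y) `^ p)%:E).
Proof.
apply/measurable_EFinP; apply: measurable_funM.
  apply: measurable_funX; apply: measurable_minr => //.
  apply: measurable_funM => //.
  under eq_fun do rewrite enorm_distC; exact: measurable_enormB.
under eq_fun do rewrite -powRN enorm_distC.
by apply: (measurableT_comp (measurable_powR _)); exact: measurable_enormB.
Qed.

(** On dyadic annuli around x, the outer contributions form a geometric series of ratio 2^(-2s); the
    inner ones, where the minimum supplies a factor (d/r)^2, form one of ratio 2^(2s-2). Both ratios
    are below 1 because 0 < s < 1. *)
Lemma gagliardo_kernel_bound (s : R) : 0 < s < 1 ->
  exists2 C : R, 0 <= C & forall (r : R) x, 0 < r ->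
  (\int[mu]_y (Num.min 1 (enorm (x - y) / r) ^+ 2
      / enorm (x - y) `^ (N%:R + 2 * s))%:E <= (C * r `^ (- (2 * s)))%:E)%E.
Proof.
move=> /andP[s0 s1]; pose t1 : R := 2 `^ (- (2 * s)).
pose t2 : R := 2 `^ (2 * s - 2).
have t1P : 0 <= t1 < 1 by apply: powR2_lt1; lra.
have t2P : 0 <= t2 < 1 by apply: powR2_lt1; lra.
(* The sums of the two series, up to r^(-2s); 4 and 8 are the ratios of the side of a covering cube
   to the inner radius of its annulus. *)
exists (4 ^+ N / (1 - t1) + 8 ^+ N * 2 `^ (2 * s) / (1 - t2)).
  case/andP: t1P t2P => ? ? /andP[? ?].
  by rewrite addr_ge0// divr_ge0 ?mulr_ge0 ?powR_ge0 ?exprn_ge0// subr_ge0 ltW.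
move=> r x r0; set b := - (2 * s); set p := N%:R + 2 * s.
have p0 : 0 < p by rewrite /p ltr_wpDl// mulr_gt0.
(* the annuli 2^i r <= d < 2^(i+1) r and 2^(-i-1) r <= d <= 2^(-i) r *)
pose c1 (i : nat) : R := (2 ^+ i * r) `^ (- p).
pose c2 (i : nat) : R := (2^-1 ^+ i) ^+ 2 * (2^-1 ^+ i.+1 * r) `^ (- p).
pose rho1 (i : nat) : R := 2 ^+ i.+1 * r.
(* Doubled because the cubes are open whereas d = 2^(-i) r is allowed. *)
pose rho2 (i : nat) : R := 2 * (2^-1 ^+ i * r).
have powp (d : R) : 0 < d -> d `^ (- p) * d ^+ N = d `^ b.
  move=> d0; rewrite -powR_mulrn ?ltW// -powRD; last by rewrite [d == 0]gt_eqF// implybT.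
  by congr (_ `^ _); rewrite /p /b; ring.
pose G (c rho : nat -> R) := fun y => (\sum_(0 <= i <oo) (c i * \1_(cube x (rho i)) y)%:E)%E.
have c10 i : 0 <= c1 i by exact: powR_ge0.
have c20 i : 0 <= c2 i by rewrite mulr_ge0 ?powR_ge0 ?exprn_ge0// invr_ge0.
have rho10 i : 0 <= rho1 i by rewrite mulr_ge0 ?exprn_ge0// ltW.
have rho20 i : 0 <= rho2 i by rewrite !mulr_ge0 ?exprn_ge0 ?invr_ge0// ltW.
have G0 (c rho : nat -> R) y : (forall i, 0 <= c i) -> (0 <= G c rho y)%E.
  by move=> c0; apply: nneseries_ge0 => i _ _; rewrite lee_fin mulr_ge0.
have mG (c rho : nat -> R) : (forall i, 0 <= c i) -> measurable_fun setT (G c rho).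
  move=> c0; apply: ge0_emeasurable_sum => [i y _ _|i _].
    by rewrite lee_fin mulr_ge0.
  apply/measurable_EFinP; apply: measurable_funM => //.
  by apply: measurable_indic; exact: measurable_cube.
apply: (@le_trans _ _ (\int[mu]_y (G c1 rho1 y + G c2 rho2 y))%E); last first.
  rewrite ge0_integralD//; [|by move=> *; exact: G0|exact: mG|
                             by move=> *; exact: G0|exact: mG].
  rewrite (@integral_geometric_cubes x c1 rho1 (4 ^+ N * r `^ b) t1)//; last first.
    move=> i; rewrite /rho1 exprS.
    rewrite (_ : 2 * _ = 4 * (2 ^+ i * r)); last by ring.
    rewrite exprMn mulrCA powp; last by rewrite mulr_gt0// exprn_gt0.
    rewrite powRM ?exprn_ge0 ?(ltW r0)// -powR_mulrn// powRAC powR_mulrn ?powR_ge0//.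
    by rewrite /t1 -/b; ring.
  rewrite (@integral_geometric_cubes x c2 rho2
    (8 ^+ N * 2 `^ (2 * s) * r `^ b) t2)//; last first.
    move=> i; rewrite /rho2.
    have q0 : 0 < 2^-1 ^+ i.+1 * r by rewrite mulr_gt0// exprn_gt0// invr_gt0.
    rewrite (_ : 2 * (2 * _) = 8 * (2^-1 ^+ i.+1 * r)); last first.
      by rewrite exprS; field.
    rewrite exprMn /c2 mulrACA powp//.
    have q2 : (2^-1 : R) `^ b = 2 `^ (2 * s).
      by rewrite -powR_inv1// -powRrM; congr (_ `^ _); rewrite /b; ring.
    have qi : (2^-1 ^+ i.+1 : R) `^ b = (2 `^ (2 * s)) ^+ i.+1.
      have h0 : 0 <= (2^-1 : R) by rewrite invr_ge0.
      by rewrite -(powR_mulrn i.+1 h0) powRAC q2 powR_mulrn ?powR_ge0.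
    have t2E : t2 = 2 `^ (2 * s) * 2^-1 ^+ 2.
      rewrite /t2 powRD; last by rewrite pnatr_eq0 implybT.
      by rewrite powRN powR_mulrn// exprVn.
    rewrite powRM ?exprn_ge0 ?invr_ge0 ?(ltW r0)// qi t2E exprMn [_ ^+ i.+1]exprS.
    by rewrite [(_ ^+ 2) ^+ i]exprAC; ring.
  rewrite -EFinD lee_fin le_eqVlt; apply/orP; left; apply/eqP; field.
  by case/andP: t1P => _ ?; case/andP: t2P => _ ?; rewrite !subr_eq0 !gt_eqF.
apply: ge0_le_integral => //.
- by move=> y _; rewrite lee_fin divr_ge0 ?sqr_ge0 ?powR_ge0.
- exact: measurable_truncated_kernel.
- by apply: emeasurable_funD; exact: mG.
move=> y _; set d := enorm (x - y).
have [->|dn0] := eqVneq d 0.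
  rewrite mul0r minEle ler10 expr0n/= mul0r; apply: adde_ge0; exact: G0.
have d0 : 0 < d by rewrite lt_def dn0 enorm_ge0.
have le_term (c rho : nat -> R) i (k : R) : (forall i, 0 <= c i) -> k <= c i -> d < rho i ->
    (k%:E <= G c rho y)%E.
  move=> c0 kc drho; apply: le_trans (nneseries_term_le i _); last first.
    by move=> j; rewrite lee_fin mulr_ge0.
  rewrite lee_fin indicE mem_set ?mulr1//; apply: eball_cube.
  by rewrite /eball/= enorm_distC.
have antip (k : R) : 0 < k -> k <= d -> d `^ (- p) <= k `^ (- p).
  move=> k0 kd; rewrite !powRN lef_pV2 ?posrE ?powR_gt0//.
  by apply: ge0_ler_powR => //; rewrite ?nnegrE; exact: ltW.
(* For d >= r the minimum is bounded by 1, for d < r by d/r <= 2^(-i); the decreasing power is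
   bounded by its value at the inner radius of the annulus. *)
have [rd|dr] := leP r d.
  have [i /andP[id di]] := @dyadic_bracket (d / r) (ltac:(by rewrite ler_pdivlMr// mul1r)).
  apply: le_trans (leeDl _ (G0 _ _ _ c20)); apply: (le_term _ _ i) => //; last first.
    by rewrite /rho1 -ltr_pdivrMr.
  apply: (@le_trans _ _ (d `^ (- p))).
    rewrite powRN ler_piMl ?invr_ge0 ?powR_ge0// exprn_ile1//.
      by rewrite le_min ler01 divr_ge0// ltW.
    by rewrite ge_min lexx.
  apply: antip; first by rewrite mulr_gt0// exprn_gt0.
  by rewrite -ler_pdivlMr.
have [i /andP[id di]] := @dyadic_bracket (r / d)
  (ltac:(by rewrite ler_pdivlMr// mul1r ltW)).
have dri : d / r <= 2^-1 ^+ i.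
  by rewrite exprVn -[_ / _]invf_div lef_pV2 ?posrE ?exprn_gt0 ?divr_gt0.
apply: le_trans (leeDr _ (G0 _ _ _ c10)); apply: (le_term _ _ i) => //; last first.
  rewrite /rho2; apply: (@le_lt_trans _ _ (2^-1 ^+ i * r)).
    by rewrite -ler_pdivrMr.
  by rewrite ltr_pMl ?ltr1n// mulr_gt0// exprn_gt0// invr_gt0.
rewrite /c2 -powRN; apply: ler_pM; rewrite ?sqr_ge0 ?powR_ge0//.
  rewrite ler_pXn2r ?nnegrE ?exprn_ge0 ?invr_ge0//.
    by rewrite ge_min dri orbT.
  by rewrite le_min ler01 divr_ge0// ltW.
apply: antip; first by rewrite mulr_gt0// exprn_gt0// invr_gt0.
by rewrite exprVn mulrC ler_pdivrMr ?exprn_gt0// mulrC -ler_pdivrMr// ltW.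
Qed.

End kernel.

(** * Effect of cutoffs on the Gagliardo seminorm *)

Section cutoff.
Context (R : realType) (N : nat) (s : R).
Implicit Types (u v w phi psi : 'rV[R]_N -> R) (x y : 'rV[R]_N).
Local Notation mu := (lebesgue_rV R N).

(** Defined on pairs so that Tonelli's theorem yields measurability of the inner integral. *)
Definition gagliardo_density u (z : 'rV[R]_N * 'rV[R]_N) : \bar R :=
  (`|u z.1 - u z.2| ^+ 2 / enorm (z.1 - z.2) `^ (N%:R + 2 * s))%:E.

Lemma gagliardo2E u :
  gagliardo2 s u = (\int[mu]_x \int[mu]_y gagliardo_density u (x, y))%E.
Proof. by []. Qed.

Lemma gagliardo_density_ge0 u z : (0 <= gagliardo_density u z)%E.
Proof. by rewrite lee_fin divr_ge0 ?sqr_ge0 ?powR_ge0. Qed.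

Lemma measurable_enorm_sub :
  measurable_fun setT (fun z : 'rV[R]_N * 'rV[R]_N => enorm (z.1 - z.2)).
Proof.
apply: measurable_enorm_fun => i; under eq_fun do rewrite !mxE.
apply: measurable_funB.
  exact: (measurableT_comp (@measurable_coord R N i) measurable_fst).
exact: (measurableT_comp (@measurable_coord R N i) measurable_snd).
Qed.

Lemma measurable_gagliardo_density u :
  measurable_fun setT u -> measurable_fun setT (gagliardo_density u).
Proof.
move=> mu_; apply/measurable_EFinP; apply: measurable_funM.
  apply: measurable_funX; apply: measurableT_comp => //.
  apply: measurable_funB.
    exact: (measurableT_comp mu_ measurable_fst).
  exact: (measurableT_comp mu_ measurable_snd).
under eq_fun do rewrite -powRN.
by apply: (measurableT_comp (measurable_powR _)); exact: measurable_enorm_sub.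
Qed.

Lemma measurable_gagliardo_section u x : measurable_fun setT u ->
  measurable_fun setT (fun y => gagliardo_density u (x, y)).
Proof.
move=> mu_; apply: (measurableT_comp (measurable_gagliardo_density mu_)).
exact: measurable_pair1.
Qed.

Lemma measurable_gagliardo_inner u : measurable_fun setT u ->
  measurable_fun setT (fun x => \int[mu]_y gagliardo_density u (x, y))%E.
Proof.
move=> mu_; apply: (@measurable_fun_fubini_tonelli_F _ _ _ _ _ mu).
  exact: measurable_gagliardo_density.
by move=> z; exact: gagliardo_density_ge0.
Qed.

Lemma gagliardo2_ge0 u : (0 <= gagliardo2 s u)%E.
Proof.
rewrite gagliardo2E; apply: integral_ge0 => x _; apply: integral_ge0 => y _.
exact: gagliardo_density_ge0.
Qed.

(* Young's inequality for the splitting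
   v(x) - v(y) = phi(y) (u(x) - u(y)) + u(x) (phi(x) - phi(y)) of v = phi u *)
Lemma cutoff_diff_le (eta m ux uy p p' q q' : R) : 0 < eta ->
  p' ^+ 2 + q' ^+ 2 <= 1 -> `|p - p'| <= m -> `|q - q'| <= m ->
  `|p * ux - p' * uy| ^+ 2 + `|q * ux - q' * uy| ^+ 2 <=
  (1 + eta) * `|ux - uy| ^+ 2 + (1 + eta^-1) * 2 * `|ux| ^+ 2 * m ^+ 2.
Proof.
move=> eta0 pq pm qm; rewrite !(real_normK (num_real _)).
have m0 : 0 <= m by apply: le_trans pm.
have young (a a' : R) : `|a - a'| <= m ->
    (a * ux - a' * uy) ^+ 2 <= (1 + eta) * (a' ^+ 2 * (ux - uy) ^+ 2) +
      (1 + eta^-1) * (ux ^+ 2 * m ^+ 2).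
  move=> am.
  have am2 : (a - a') ^+ 2 <= m ^+ 2.
    by rewrite -real_normK ?num_real// ler_pXn2r ?nnegrE.
  apply: (@le_trans _ _ ((1 + eta) * (a' ^+ 2 * (ux - uy) ^+ 2) +
      (1 + eta^-1) * (ux ^+ 2 * (a - a') ^+ 2))); last first.
    rewrite lerD2l ler_wpM2l ?addr_ge0 ?invr_ge0 ?(ltW eta0)//.
    by rewrite ler_wpM2l ?sqr_ge0.
  rewrite -subr_ge0 (_ : _ - _ =
      (eta * (a' * (ux - uy)) - ux * (a - a')) ^+ 2 / eta).
    by rewrite divr_ge0 ?sqr_ge0// ltW.
  by field; rewrite gt_eqF.
(* Summing before using p'^2 + q'^2 <= 1 produces the factor 1 + eta once, not twice. *)
apply: (le_trans (lerD (young _ _ pm) (young _ _ qm))).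
rewrite [leLHS](_ : _ = (1 + eta) * ((p' ^+ 2 + q' ^+ 2) * (ux - uy) ^+ 2) +
  (1 + eta^-1) * 2 * ux ^+ 2 * m ^+ 2); last by ring.
rewrite lerD2r ler_wpM2l ?addr_ge0 ?(ltW eta0)//.
by rewrite ler_piMl ?sqr_ge0.
Qed.

(** A small eta makes the coefficient of [u]^2 close to 1, and a large r then compensates for
    eta^-1, because the kernel integral decays like r^(-2s) uniformly in x. *)
Lemma gagliardo2_cutoff : 0 < s < 1 ->
  exists2 C : R, 0 <= C & forall u phi psi (r eta : R),
  measurable_fun setT u -> measurable_fun setT phi -> measurable_fun setT psi ->
  0 < r -> 0 < eta -> (forall x, phi x ^+ 2 + psi x ^+ 2 <= 1) ->
  (forall x y, `|phi x - phi y| <= Num.min 1 (enorm (x - y) / r)) ->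
  (forall x y, `|psi x - psi y| <= Num.min 1 (enorm (x - y) / r)) ->
  (gagliardo2 s (fun x => phi x * u x)%R + gagliardo2 s (fun x => psi x * u x)%R <=
   (1 + eta)%:E * gagliardo2 s u +
   ((1 + eta^-1) * (C * r `^ (- (2 * s))))%:E * \int[mu]_x (`|u x| ^+ 2)%:E)%E.
Proof.
move=> s01; have [C C0 kerC] := gagliardo_kernel_bound N s01.
(* One kernel bound for each of the two cutoffs. *)
exists (2 * C); first by rewrite mulr_ge0.
move=> u phi psi r eta m_u mphi mpsi r0 eta0 pp1 phiL psiL.
set v := (fun x => phi x * u x); set w := (fun x => psi x * u x).
have mv : measurable_fun setT v by exact: measurable_funM.
have mw : measurable_fun setT w by exact: measurable_funM.
have d0 := gagliardo_density_ge0.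
have di0 f x : (0 <= \int[mu]_y gagliardo_density f (x, y))%E.
  by apply: integral_ge0 => y _; exact: d0.
pose p := N%:R + 2 * s.
pose K x y := (Num.min 1 (enorm (x - y) / r) ^+ 2 / enorm (x - y) `^ p)%:E.
have K0 x y : (0 <= K x y)%E by rewrite lee_fin divr_ge0 ?sqr_ge0 ?powR_ge0.
have mK x : measurable_fun setT (K x) by exact: measurable_truncated_kernel.
have eta1 : 0 <= 1 + eta by rewrite addr_ge0// ltW.
have eta1V : 0 <= 1 + eta^-1 by rewrite addr_ge0// invr_ge0 ltW.
have mu2 : measurable_fun setT (fun x => (`|u x| ^+ 2)%:E).
  by apply/measurable_EFinP; apply: measurable_funX; apply: measurableT_comp.
rewrite !gagliardo2E -ge0_integralD//; last 2 first.
- exact: measurable_gagliardo_inner.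
- exact: measurable_gagliardo_inner.
set c := (1 + eta^-1) * (2 * C * r `^ (- (2 * s))).
have c0 : 0 <= c by rewrite !mulr_ge0 ?powR_ge0.
rewrite -ge0_integralZl_EFin//; last exact: measurable_gagliardo_inner.
rewrite -ge0_integralZl_EFin//.
rewrite -ge0_integralD//; last 4 first.
- by move=> x _; rewrite mule_ge0// lee_fin.
- by apply: measurable_funeM; exact: measurable_gagliardo_inner.
- by move=> x _; rewrite mule_ge0// lee_fin ?sqr_ge0.
- exact: measurable_funeM.
apply: ge0_le_integral => //.
- by move=> x _; exact: adde_ge0.
- by apply: emeasurable_funD; exact: measurable_gagliardo_inner.
- apply: emeasurable_funD; apply: measurable_funeM => //.
  exact: measurable_gagliardo_inner.
move=> x _.
rewrite -ge0_integralD//; [|exact: measurable_gagliardo_section..].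
(* The error carries u(x), not u(y), so it is a constant factor in the inner integral. *)
pose k := (1 + eta^-1) * 2 * `|u x| ^+ 2.
have k0 : 0 <= k by rewrite !mulr_ge0.
apply: (@le_trans _ _
  (\int[mu]_y ((1 + eta)%:E * gagliardo_density u (x, y) + k%:E * K x y))%E).
  apply: ge0_le_integral => //.
  - by move=> y _; exact: adde_ge0.
  - by apply: emeasurable_funD; exact: measurable_gagliardo_section.
  - apply: emeasurable_funD; apply: measurable_funeM => //.
    exact: measurable_gagliardo_section.
  move=> y _; rewrite -!EFinM -!EFinD lee_fin -mulrDl /=.
  rewrite (mulrA (1 + eta)) (mulrA k) -[leRHS]mulrDl.
  by rewrite ler_wpM2r ?invr_ge0 ?powR_ge0// cutoff_diff_le.
rewrite ge0_integralD//; last 4 first.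
- by move=> y _; rewrite mule_ge0// lee_fin.
- by apply: measurable_funeM; exact: measurable_gagliardo_section.
- by move=> y _; rewrite mule_ge0.
- exact: measurable_funeM.
rewrite !ge0_integralZl_EFin//; last exact: measurable_gagliardo_section.
rewrite leeD2l//.
apply: (le_trans (lee_wpmul2l _ (kerC r x r0))); first by rewrite lee_fin.
by rewrite -!EFinM lee_fin /k /c le_eqVlt; apply/orP; left; apply/eqP; ring.
Qed.

End cutoff.

(** * The L^2 norm as an integral of squares *)

Section L2.
Context d (T : measurableType d) (R : realType) (mu : {measure set T -> \bar R}).
Local Open Scope ereal_scope.

Lemma sqr_Lnorm2 (f : T -> R) :
  'N[mu]_2%:E[EFin \o f] ^+ 2 = \int[mu]_x (`|f x| ^+ 2)%:E.
Proof.
have intE : \int[mu]_x (`|(EFin \o f) x| `^ 2) = \int[mu]_x (`|f x| ^+ 2)%:E.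
  by apply: eq_integral => x _; congr EFin; exact: powR_mulrn.
have i0 : 0 <= \int[mu]_x (`|f x| ^+ 2)%:E.
  by apply: integral_ge0 => x _; rewrite lee_fin sqr_ge0.
by rewrite unlock intE poweR12_sqrt// sqr_sqrte.
Qed.

Lemma Lnorm2_le (f : T -> R) (e : R) : (0 <= e)%R ->
  \int[mu]_x (`|f x| ^+ 2)%:E <= (e ^+ 2)%:E ->
  'N[mu]_2%:E[EFin \o f] <= e%:E.
Proof.
move=> e0; rewrite -sqr_Lnorm2 EFin_expe.
by apply: lee_sqrE; rewrite lee_fin.
Qed.

Lemma Lfun2P (f : T -> R) : f \in Lfun mu 2%:E <->
  measurable_fun setT f /\ \int[mu]_x (`|f x| ^+ 2)%:E < +oo.
Proof.
have finE : ('N[mu]_2%:E[EFin \o f] < +oo) = (\int[mu]_x (`|f x| ^+ 2)%:E < +oo).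
  rewrite -sqr_Lnorm2; have := Lnorm_ge0 mu 2%:E (EFin \o f).
  case: ('N[mu]_2%:E[EFin \o f]) => [r _||//]; first by rewrite -EFin_expe !ltry.
  by rewrite expe2 mulyy.
split; rewrite inE.
  by move=> /andP[/[!inE]/= mf]; rewrite /finite_norm finE.
move=> [mf ff]; apply/andP; split; rewrite inE//=.
by rewrite /finite_norm finE.
Qed.

End L2.

(** * Membership in H^s and its stability under cutoffs *)

Section Hs.
Context (R : realType) (N : nat) (s : R).
Implicit Types (u phi : 'rV[R]_N -> R).
Local Notation mu := (lebesgue_rV R N).
Local Open Scope ereal_scope.

Lemma HsP u : Hs s u <->
  [/\ measurable_fun setT u, \int[mu]_x (`|u x| ^+ 2)%:E < +oo &
      gagliardo2 s u < +oo].
Proof.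
split; first by move=> [/Lfun2P[]].
by move=> [? ? ?]; split => //; exact/Lfun2P.
Qed.

Lemma gagliardo2_le_Hs_norm u (M : R) :
  Hs_norm s u <= M%:E -> gagliardo2 s u <= (M ^+ 2)%:E.
Proof.
move=> uM; have M0 : (0 <= M)%R.
  by rewrite -lee_fin (le_trans _ uM)// sqrte_ge0.
have g0 := gagliardo2_ge0 s u.
have n0 : 0 <= 'N[mu]_2%:E[EFin \o u] ^+ 2 by exact: sqre_ge0.
apply: (@le_trans _ _ ('N[mu]_2%:E[EFin \o u] ^+ 2 + gagliardo2 s u)).
  by rewrite leeDr.
rewrite -(sqr_sqrte (adde_ge0 n0 g0)) EFin_expe.
by rewrite lee_sqr ?lee_fin ?sqrte_ge0.
Qed.

Lemma Hs_cutoff u phi (r : R) : (0 < s < 1)%R -> (0 < r)%R -> Hs s u ->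
  measurable_fun setT phi -> (forall x, `|phi x| <= 1)%R ->
  (forall x y, `|phi x - phi y| <= Num.min 1 (enorm (x - y) / r))%R ->
  Hs s (fun x => phi x * u x)%R.
Proof.
move=> s01 r0 /HsP[m_u fu gu] mphi phi1 phiL; apply/HsP; split.
- exact: measurable_funM.
- apply: le_lt_trans fu; apply: ge0_le_integral => //.
  + apply/measurable_EFinP; apply: measurable_funX; apply: measurableT_comp => //.
    exact: measurable_funM.
  + by apply/measurable_EFinP; apply: measurable_funX; apply: measurableT_comp.
  + move=> x _; rewrite lee_fin normrM exprMn ler_piMl ?sqr_ge0//.
    by rewrite exprn_ile1.
(* The two-cutoff estimate with psi = 0 and eta = 1 gives finiteness. *)
- have [C C0 gC] := @gagliardo2_cutoff R N s s01.
  have pp x : (phi x ^+ 2 + (cst 0 x : R) ^+ 2 <= 1)%R.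
    by rewrite /= expr0n addr0 -real_normK ?num_real// exprn_ile1.
  have zL (x y : 'rV[R]_N) : (`|cst 0 x - cst 0 y : R| <= Num.min 1 (enorm (x - y) / r))%R.
    by rewrite /= subrr normr0 le_min ler01 divr_ge0 ?enorm_ge0// ltW.
  have := gC u phi (cst 0%R) r 1%R m_u mphi (measurable_cst _) r0 ltr01 pp phiL zL.
  move=> /(le_trans (leeDl _ (gagliardo2_ge0 _ _)))/le_lt_trans; apply.
  apply: lte_add_pinfty; first by rewrite lte_mul_pinfty// lee_fin addr_ge0.
  by rewrite lte_mul_pinfty// lee_fin !mulr_ge0 ?powR_ge0.
Qed.

End Hs.

(** * Masses of |u|^2 against weights with values in [0, 1] *)

Section weighted_mass.
Context d (T : measurableType d) (R : realType) (mu : {measure set T -> \bar R}).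
Variable u : T -> R.

(** Real values turn later mass estimates into linear arithmetic; for a [weight] and u in L^2,
    [wmassE] shows that [fine] loses nothing. *)
Definition wmass (a : T -> R) : R :=
  fine (\int[mu]_x (a x * `|u x| ^+ 2)%:E)%E.

Definition weight (a : T -> R) :=
  measurable_fun setT a /\ forall x, 0 <= a x <= 1.

Lemma weight1 : weight (cst 1).
Proof. by split => [|x]; [exact: measurable_cst|rewrite ler01 lexx]. Qed.

Lemma weight_indic (A : set T) : measurable A -> weight \1_A.
Proof.
by move=> mA; split => [|x]; [exact: measurable_indic|
  rewrite indicE; case: (x \in A); rewrite ?ler01 ?lexx].
Qed.

Lemma weight_sqr (a : T -> R) : weight a -> weight (fun x => a x ^+ 2).
Proof.
move=> [ma a01]; split => [|x]; first exact: measurable_funX.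
by have /andP[a0 a1] := a01 x; rewrite exprn_ge0// exprn_ile1.
Qed.

Hypothesis m_u : measurable_fun setT u.
Hypothesis fu : (\int[mu]_x (`|u x| ^+ 2)%:E < +oo)%E.

Let mw a : weight a -> measurable_fun setT (fun x => (a x * `|u x| ^+ 2)%:E).
Proof.
move=> [ma _]; apply/measurable_EFinP; apply: measurable_funM => //.
by apply: measurable_funX; apply: measurableT_comp.
Qed.

Let w0 a x : weight a -> (0 <= (a x * `|u x| ^+ 2)%:E)%E.
Proof. by move=> [_ /(_ x)/andP[a0 _]]; rewrite lee_fin mulr_ge0. Qed.

Lemma wmassE a : weight a ->
  (\int[mu]_x (a x * `|u x| ^+ 2)%:E)%E = (wmass a)%:E.
Proof.
move=> wa; rewrite /wmass fineK// ge0_fin_numE; last first.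
  by apply: integral_ge0 => x _; exact: w0.
apply: le_lt_trans fu; apply: ge0_le_integral => //.
- by move=> x _; exact: w0.
- exact: mw.
- by apply/measurable_EFinP; apply: measurable_funX; apply: measurableT_comp.
move=> x _; have [_ /(_ x)/andP[a0 a1]] := wa.
by rewrite lee_fin ler_piMl// sqr_ge0.
Qed.

Lemma wmass_ge0 a : weight a -> 0 <= wmass a.
Proof. by move=> wa; rewrite -lee_fin -wmassE// integral_ge0// => x _; exact: w0. Qed.

(** Additivity and monotonicity in one statement: with its counterpart [wmassD_ge], it reduces mass
    estimates to pointwise inequalities of weights. *)
Lemma wmassD_le a b c : weight a -> weight b -> weight c ->
  (forall x, a x + b x <= c x) -> wmass a + wmass b <= wmass c.
Proof.
move=> wa wb wc abc; rewrite -lee_fin EFinD -!wmassE// -ge0_integralD//; last 4 first.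
- by move=> x _; exact: w0.
- exact: mw.
- by move=> x _; exact: w0.
- exact: mw.
apply: ge0_le_integral => //; [|by apply: emeasurable_funD; exact: mw|exact: mw|].
- by move=> x _; apply: adde_ge0; exact: w0.
- by move=> x _; rewrite -EFinD lee_fin -mulrDl ler_wpM2r ?sqr_ge0.
Qed.

Lemma wmassD_ge a b c : weight a -> weight b -> weight c ->
  (forall x, c x <= a x + b x) -> wmass c <= wmass a + wmass b.
Proof.
move=> wa wb wc abc; rewrite -lee_fin EFinD -!wmassE// -ge0_integralD//; last 4 first.
- by move=> x _; exact: w0.
- exact: mw.
- by move=> x _; exact: w0.
- exact: mw.
apply: ge0_le_integral => //; [|exact: mw|by apply: emeasurable_funD; exact: mw|].
- by move=> x _; exact: w0.
- by move=> x _; rewrite -EFinD lee_fin -mulrDl ler_wpM2r ?sqr_ge0.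
Qed.

Lemma le_wmass a b : weight a -> weight b -> (forall x, a x <= b x) ->
  wmass a <= wmass b.
Proof.
move=> wa wb ab; have w00 : weight (cst 0).
  by split => [|x]; [exact: measurable_cst|rewrite lexx ler01].
have := wmassD_le wa w00 wb (fun x => (ltac:(by rewrite addr0))).
by apply: le_trans; rewrite lerDl wmass_ge0.
Qed.

Lemma integral_mul_sqr_wmass a : weight a ->
  (\int[mu]_x (`|a x * u x| ^+ 2)%:E)%E = (wmass (fun x => a x ^+ 2)%R)%:E.
Proof.
move=> wa; rewrite -wmassE; last exact: weight_sqr.
apply: eq_integral => x _; rewrite normrM exprMn.
by rewrite real_normK ?num_real.
Qed.

Lemma integral_sqr_wmass : (\int[mu]_x (`|u x| ^+ 2)%:E)%E = (wmass (cst 1))%:E.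
Proof.
rewrite -wmassE; last exact: weight1.
by apply: eq_integral => x _; rewrite /= mul1r.
Qed.

Lemma integral_in_sqr_wmass (A : set T) : measurable A ->
  (\int[mu]_(x in A) (`|u x| ^+ 2)%:E)%E = (wmass \1_A)%:E.
Proof.
move=> mA; rewrite -wmassE; last exact: weight_indic.
rewrite integral_mkcond; apply: eq_integral => x _.
by rewrite patchE indicE; case: (x \in A); rewrite ?mul1r ?mul0r.
Qed.

Lemma wmass_indic_le (A : set T) : measurable A -> wmass \1_A <= wmass (cst 1).
Proof.
move=> mA; apply: le_wmass; [exact: weight_indic|exact: weight1|move=> x].
by have [_ /(_ x)/andP[]] := weight_indic mA.
Qed.

Lemma wmass_indic_subset (A B : set T) : measurable A -> measurable B ->
  A `<=` B -> wmass \1_A <= wmass \1_B.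
Proof.
move=> mA mB AB; apply: le_wmass; [exact: weight_indic..|move=> x].
rewrite !indicE; have [xA|_] := boolP (x \in A); last by case: (_ \in _).
by rewrite mem_set//; apply: AB; exact: set_mem.
Qed.

End weighted_mass.

(** * Radial Lipschitz cutoffs *)

Section radial_cutoff.
Context (R : realType) (N : nat).
Implicit Types (x y z : 'rV[R]_N) (r : R).

(** A truncated cone: 1 up to distance r from y, 0 from distance 2r on, affine in the distance
    between. *)
Definition radial_cutoff y r x : R :=
  Num.max 0 (Num.min 1 (2 - enorm (x - y) / r)).

Lemma radial_cutoff_ge0_le1 y r x : 0 <= radial_cutoff y r x <= 1.
Proof. by rewrite le_max lexx/= ge_max ler01 ge_min lexx. Qed.

Lemma measurable_radial_cutoff y r : measurable_fun setT (radial_cutoff y r).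
Proof.
apply: measurable_maxr => //; apply: measurable_minr => //.
apply: measurable_funB => //; apply: measurable_funM => //.
exact: measurable_enormB.
Qed.

Lemma weight_radial_cutoff y r : weight (radial_cutoff y r).
Proof.
by split; [exact: measurable_radial_cutoff|exact: radial_cutoff_ge0_le1].
Qed.

Lemma weight_radial_cutoffC y r : weight (fun x => 1 - radial_cutoff y r x).
Proof.
split=> [|x]; last by have := radial_cutoff_ge0_le1 y r x; lra.
by apply: measurable_funB => //; exact: measurable_radial_cutoff.
Qed.

Lemma radial_cutoff1 y r x : 0 < r -> eball y r x -> radial_cutoff y r x = 1.
Proof.
rewrite /eball/= => r0 xyr; rewrite /radial_cutoff.
have h : enorm (x - y) / r <= 1 by rewrite ler_pdivrMr// mul1r ltW.
by rewrite min_l ?max_r// lerBrDr; lra.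
Qed.

Lemma radial_cutoff0 y r x : 0 < r -> ~ eball y (2 * r) x -> radial_cutoff y r x = 0.
Proof.
rewrite /eball/= => r0 /negP; rewrite -leNgt => xyr; rewrite /radial_cutoff.
have h : 2 <= enorm (x - y) / r by rewrite ler_pdivlMr.
by rewrite max_l// ge_min; apply/orP; right; lra.
Qed.

(** Truncation to [0, 1] is 1-Lipschitz with range of diameter 1; each argument falls on one of
    three affine pieces. *)
Lemma clamp_lipschitz (t t' : R) :
  `|Num.max 0 (Num.min 1 t) - Num.max 0 (Num.min 1 t')| <= Num.min 1 `|t - t'|.
Proof.
have clampP (x : R) : let p := Num.max 0 (Num.min 1 x) in
    [\/ x <= 0 /\ p = 0, 0 <= x <= 1 /\ p = x | 1 <= x /\ p = 1].
  have [x1|x1] := leP 1 x; first by constructor 3; rewrite max_r.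
  have [x0|x0] := leP 0 x; first by constructor 2; rewrite ltW.
  by constructor 1; rewrite ltW.
have n1 : t - t' <= `|t - t'| by exact: ler_norm.
have n2 : t' - t <= `|t - t'| by rewrite distrC; exact: ler_norm.
rewrite le_min !ler_norml; have := clampP t; have := clampP t'; move=> /=.
by case=> -[? ->]; case=> -[? ->]; lra.
Qed.

(** In the minimum, the quotient makes the kernel integrable near the diagonal and the 1 makes it
    integrable at infinity. *)
Lemma radial_cutoff_lipschitz y r x z : 0 < r ->
  `|radial_cutoff y r x - radial_cutoff y r z| <= Num.min 1 (enorm (x - z) / r).
Proof.
move=> r0; apply: (le_trans (clamp_lipschitz _ _)).
rewrite le_min ge_min lexx/= ge_min; apply/orP; right.
rewrite (_ : _ - _ = (enorm (z - y) - enorm (x - y)) / r); last by ring.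
rewrite normrM.
rewrite (gtr0_norm (x := r^-1)) ?invr_gt0// ler_wpM2r ?invr_ge0 ?(ltW r0)//.
rewrite distrC; apply: (le_trans (ler_dist_enorm _ _)).
by rewrite opprB addrA subrK.
Qed.

End radial_cutoff.

(** * Supports and their distance *)

Section support.
Context (R : realType) (N : nat).
Implicit Types (u : 'rV[R]_N -> R) (A B U : set 'rV[R]_N) (x y : 'rV[R]_N).

Lemma supp_subset u U : open U -> (forall x, U x -> u x = 0) -> supp u `<=` ~` U.
Proof.
move=> oU U0 x sx Ux; apply: sx; exists U => //; split => //.
exact: aeW.
Qed.

Lemma le_set_dist A B (r : R) :
  (forall x y, A x -> B y -> r <= enorm (x - y)) -> (r%:E <= set_dist A B)%E.
Proof.
move=> rAB; apply: le_ereal_inf_tmp => _ [x Ax [y By <-]].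
by rewrite lee_fin rAB.
Qed.

Lemma continuous_enormB y : continuous (fun x => enorm (x - y)).
Proof.
move=> x; apply: (@continuous_comp _ _ _ (fun x => x - y) (@enorm R N)).
  by apply: (@continuousB _ 'rV[R]_N); [exact: cvg_id|exact: cst_continuous].
exact: continuous_enorm.
Qed.

Lemma open_eball y (r : R) : open (eball y r).
Proof.
apply: (@open_comp _ _ (fun x => enorm (x - y)) [set t | t < r]) => //.
by move=> x _; exact: continuous_enormB.
Qed.

Lemma open_eballC y (r : R) : open [set x | r < enorm (x - y)].
Proof.
apply: (@open_comp _ _ (fun x => enorm (x - y)) [set t | r < t]) => //.
by move=> x _; exact: continuous_enormB.
Qed.

(** The first product vanishes on the open set |t - y| > 2 r1 and the second on the open ball of
    radius r2, so the supports avoid these sets and the triangle inequality applies. *)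
Lemma set_dist_cutoff u y (r1 r2 : R) : 0 < r1 -> 0 < r2 ->
  ((r2 - 2 * r1)%:E <=
    set_dist (supp (fun x => radial_cutoff y r1 x * u x)%R)
             (supp (fun x => (1 - radial_cutoff y r2 x) * u x)%R))%E.
Proof.
move=> r10 r20; apply: le_set_dist => x z xv zw.
have v0 t : 2 * r1 < enorm (t - y) -> radial_cutoff y r1 t * u t = 0.
  move=> tr; rewrite radial_cutoff0 ?mul0r//.
  by rewrite /eball/= => /lt_trans/(_ tr); rewrite ltxx.
have w0 t : eball y r2 t -> (1 - radial_cutoff y r2 t) * u t = 0.
  by move=> tr; rewrite radial_cutoff1// subrr mul0r.
have xr : enorm (x - y) <= 2 * r1.
  by rewrite leNgt; apply/negP; exact: (supp_subset (@open_eballC y (2 * r1)) v0 xv).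
have zr : r2 <= enorm (z - y).
  by rewrite leNgt; apply/negP; exact: (supp_subset (@open_eball y r2) w0 zw).
have : enorm (z - y) <= enorm (z - x) + enorm (x - y).
  by apply: le_trans (ler_enormD _ _); rewrite addrA subrK.
by rewrite (enorm_distC z x); lra.
Qed.

End support.

(** * Levy's concentration function *)

Section concentration_function.
Context (R : realType) (N : nat).
Implicit Types (u : 'rV[R]_N -> R) (y : 'rV[R]_N) (r : R).
Local Notation mu := (lebesgue_rV R N).
Local Notation mass u A := (wmass mu u \1_A).
Local Notation total u := (wmass mu u (cst 1)).

(** For u in L^2 the supremum lies between 0 and the total mass, so [fine] loses nothing; see
    [concentrationE]. *)
Definition concentration u r : R :=
  fine (ereal_sup [set \int[mu]_(x in eball y r) (`|u x| ^+ 2)%:E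
                  | y in [set: 'rV[R]_N]]%E).

Variable u : 'rV[R]_N -> R.
Hypothesis m_u : measurable_fun setT u.
Hypothesis fu : (\int[mu]_x (`|u x| ^+ 2)%:E < +oo)%E.

Lemma concentrationE r :
  ereal_sup [set \int[mu]_(x in eball y r) (`|u x| ^+ 2)%:E
            | y in [set: 'rV[R]_N]]%E = (concentration u r)%:E.
Proof.
rewrite /concentration fineK//; set S := (X in ereal_sup X).
have S0 : (0 <= ereal_sup S)%E.
  apply: le_ereal_sup_tmp.
  exists (\int[mu]_(x in eball 0 r) (`|u x| ^+ 2)%:E)%E; first by exists 0.
  by apply: integral_ge0 => x _; rewrite lee_fin sqr_ge0.
rewrite ge0_fin_numE//; apply: (@le_lt_trans _ _ (total u)%:E); last exact: ltry.
apply: ge_ereal_sup => _ [y _ <-].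
rewrite integral_in_sqr_wmass//; last exact: measurable_eball.
by rewrite lee_fin wmass_indic_le//; exact: measurable_eball.
Qed.

Lemma mass_eball_le_concentration y r : mass u (eball y r) <= concentration u r.
Proof.
rewrite -lee_fin -concentrationE -integral_in_sqr_wmass//; last first.
  exact: measurable_eball.
by apply: ereal_sup_ubound; exists y.
Qed.

Lemma concentration_le_total r : concentration u r <= total u.
Proof.
rewrite -lee_fin -concentrationE; apply: ge_ereal_sup => _ [y _ <-].
rewrite integral_in_sqr_wmass//; last exact: measurable_eball.
by rewrite lee_fin wmass_indic_le//; exact: measurable_eball.
Qed.

Lemma concentration_ge0 r : 0 <= concentration u r.
Proof.
apply: le_trans (mass_eball_le_concentration 0 r).
by apply: wmass_ge0 => //; apply: weight_indic; exact: measurable_eball.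
Qed.

Lemma lt_concentration (a : R) r : a < concentration u r ->
  exists y, a < mass u (eball y r).
Proof.
rewrite -lte_fin -concentrationE => /ereal_sup_gt[_ [y _ <-]].
rewrite integral_in_sqr_wmass//; last exact: measurable_eball.
by rewrite lte_fin; exists y.
Qed.

Lemma le_concentration r r' : r <= r' -> concentration u r <= concentration u r'.
Proof.
move=> rr'; rewrite -lee_fin -concentrationE; apply: ge_ereal_sup => _ [y _ <-].
rewrite integral_in_sqr_wmass//; last exact: measurable_eball.
rewrite lee_fin; apply: le_trans (mass_eball_le_concentration y r').
apply: wmass_indic_subset => //; [exact: measurable_eball..|].
by apply: eball_subset; rewrite subrr /enorm big1 ?sqrtr0 ?add0r// => i _;
  rewrite mxE expr0n.
Qed.

End concentration_function.

(** Replaces squared cutoffs by the cutoffs themselves, so that linear arithmetic applies. *)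
Lemma sqr_le_self (R : realDomainType) (t : R) : 0 <= t <= 1 -> t ^+ 2 <= t.
Proof. by move=> /andP[t0 t1]; rewrite expr2 ler_piMl. Qed.

(** * Splitting the mass by an inner and an outer cutoff *)

Section splitting.
Context (R : realType) (N : nat).
Local Notation mu := (lebesgue_rV R N).
Local Notation mass u A := (wmass mu u \1_A).
Local Notation total u := (wmass mu u (cst 1)).
Variables (u : 'rV[R]_N -> R) (y : 'rV[R]_N) (r1 r2 : R).
Hypotheses (r10 : 0 < r1) (r12 : 2 * r1 <= r2).
Local Notation phi := (radial_cutoff y r1).
Local Notation Phi := (radial_cutoff y r2).

(** The condition 2 r1 <= r2 puts the transition layer of phi where Phi = 1. The estimates of this
    section follow pointwise from this chain. *)
Lemma radial_cutoff_chain x :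
  [/\ \1_(eball y r1) x <= phi x, phi x <= \1_(eball y r2) x,
      \1_(eball y r2) x <= Phi x & Phi x <= \1_(eball y (2 * r2)) x :> R].
Proof.
have r20 : 0 < r2 by apply: lt_le_trans r12; rewrite mulr_gt0.
have /andP[p0 p1] := radial_cutoff_ge0_le1 y r1 x.
have /andP[P0 P1] := radial_cutoff_ge0_le1 y r2 x.
split; rewrite indicE; case: (boolP (x \in _)) => //=.
- by move=> /set_mem xr; rewrite radial_cutoff1.
- move=> /negP xr; rewrite radial_cutoff0// => xr1; apply: xr; apply/mem_set.
  by move: xr1; rewrite /eball/= => /lt_le_trans; exact.
- by move=> /set_mem xr; rewrite radial_cutoff1.
- by move=> /negP xr; rewrite radial_cutoff0// => xr1; apply: xr; exact/mem_set.
Qed.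

(** As phi <= Phi, the left side is at most phi + 1 - Phi <= 1. *)
Lemma sqr_radial_cutoff_le x : phi x ^+ 2 + (1 - Phi x) ^+ 2 <= 1.
Proof.
have [_ h2 h3 _] := radial_cutoff_chain x.
have p01 := radial_cutoff_ge0_le1 y r1 x.
have [_ P01] := weight_radial_cutoffC y r2.
by have := sqr_le_self p01; have := sqr_le_self (P01 x); lra.
Qed.

Hypothesis m_u : measurable_fun setT u.
Hypothesis fu : (\int[mu]_x (`|u x| ^+ 2)%:E < +oo)%E.

Let wB r : weight (\1_(eball y r) : _ -> R).
Proof. by apply: weight_indic; exact: measurable_eball. Qed.

Let wphi2 := weight_sqr (weight_radial_cutoff y r1).
Let wpsi2 := weight_sqr (weight_radial_cutoffC y r2).

Let indic01 (A : set 'rV[R]_N) x : (\1_A x = 0 :> R) \/ (\1_A x = 1 :> R).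
Proof. by rewrite indicE; case: (_ \in _); [right|left]. Qed.

(** Both bounds use only the balls of radii r1 and 2 r2, whose masses will both be close to
    alpha. *)
Lemma wmass_inner_cutoff :
  mass u (eball y r1) <= wmass mu u (fun x => phi x ^+ 2) <= mass u (eball y (2 * r2)).
Proof.
apply/andP; split; apply: le_wmass => // x; have [h1 h2 h3 h4] := radial_cutoff_chain x;
  have p01 := radial_cutoff_ge0_le1 y r1 x.
  have [->|e] := indic01 (eball y r1) x; first exact: sqr_ge0.
  have -> : phi x = 1 by move: p01 h1; rewrite e; lra.
  by rewrite e expr1n.
by have := sqr_le_self p01; lra.
Qed.

Lemma wmass_outer_cutoff :
  total u - mass u (eball y (2 * r2)) <= wmass mu u (fun x => (1 - Phi x) ^+ 2)
    <= total u - mass u (eball y r1).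
Proof.
have [_ P01] := weight_radial_cutoffC y r2.
apply/andP; split.
  rewrite lerBlDr; apply: wmassD_ge => //; first exact: weight1.
  move=> x /=; have [_ _ _ h4] := radial_cutoff_chain x.
  have [e|->] := indic01 (eball y (2 * r2)) x; last by rewrite lerDr sqr_ge0.
  have -> : Phi x = 0.
    by have := radial_cutoff_ge0_le1 y r2 x; move: h4; rewrite e; lra.
  by rewrite e subr0 expr1n addr0.
rewrite lerBrDr; apply: wmassD_le => //; first exact: weight1.
move=> x /=; have [h1 h2 h3 h4] := radial_cutoff_chain x.
by have := sqr_le_self (P01 x); lra.
Qed.

(** The remainder is (Phi - phi) u, and (Phi - phi)^2 <= Phi - phi is at most the indicator of the
    annulus between r1 and 2 r2. *)
Lemma integral_splitting_remainder :
  (\int[mu]_x (`|u x - phi x * u x - (1 - Phi x) * u x| ^+ 2)%:E <=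
   (mass u (eball y (2 * r2)) - mass u (eball y r1))%:E)%E.
Proof.
have wchi : weight (fun x => Phi x - phi x).
  split=> [|x]; first by apply: measurable_funB; exact: measurable_radial_cutoff.
  have [h1 h2 h3 h4] := radial_cutoff_chain x.
  have /andP[p0 p1] := radial_cutoff_ge0_le1 y r1 x.
  by have /andP[P0 P1] := radial_cutoff_ge0_le1 y r2 x; lra.
rewrite (_ : (\int[mu]_x _)%E =
    (\int[mu]_x (`|(Phi x - phi x) * u x| ^+ 2)%:E)%E); last first.
  by apply: eq_integral => x _; congr ((`|_| ^+ 2)%:E); ring.
rewrite integral_mul_sqr_wmass// lee_fin lerBrDr; apply: wmassD_le => //.
  exact: weight_sqr.
move=> x /=; have [h1 h2 h3 h4] := radial_cutoff_chain x.
by have [_ /(_ x)/sqr_le_self] := wchi; lra.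
Qed.

End splitting.

Lemma near_invS (R : realType) (e : R) : 0 < e ->
  \forall k \near \oo, k.+1%:R^-1 < e.
Proof. by move=> e0; exact: near_infty_natSinv_lt (PosNum e0). Qed.

(** * The three cases, from the limits of the concentration functions *)

Section cases.
Context (R : realType) (N : nat).
Local Notation mu := (lebesgue_rV R N).
Local Notation mass u A := (wmass mu u \1_A).
Local Notation total u := (wmass mu u (cst 1)).

(** With b^a = D/e + 1, every r >= b satisfies D r^(-a) <= e, so max(m, b) will do. *)
Lemma powR_decay (a D e m : R) : 0 < a -> 0 <= D -> 0 < e ->
  exists r : R, [/\ 0 < r, m <= r & D * r `^ (- a) <= e].
Proof.
move=> a0 D0 e0; pose b := (D / e + 1) `^ a^-1.
have De0 : 0 <= D / e by rewrite divr_ge0// ltW.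
have b0 : 0 < b by rewrite powR_gt0; lra.
exists (Num.max m b); rewrite lt_max b0 orbT le_max lexx; split => //.
have ba : b `^ a = D / e + 1 by rewrite /b -powRrM mulVf ?gt_eqF// powRr1//; lra.
have : b `^ a <= Num.max m b `^ a.
  apply: ge0_ler_powR; rewrite ?nnegrE ?le_max ?lexx ?orbT//; first exact: ltW.
  - exact: ltW.
  - by rewrite (ltW b0) orbT.
rewrite ba powRN; set t := _ `^ a => h.
have t0 : 0 < t by lra.
rewrite ler_pdivrMr// -ler_pdivrMl// mulrC; lra.
Qed.

(** Here [u] stands for the extracted subsequence and [alpha] for the supremum of [q]. In [conc_q]
    the radius may grow with k up to k + 1, which the dichotomy relies on. *)
Variables (s lambda M alpha : R) (u : nat -> 'rV[R]_N -> R) (q : nat -> R).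
Hypothesis s01 : 0 < s < 1.
Hypothesis Hu : forall k, Hs s (u k).
Hypothesis gM : forall k, (gagliardo2 s (u k) <= M%:E)%E.
Hypothesis cvg_total : total (u k) @[k --> \oo] --> lambda.
Hypothesis conc_q : forall k m, (m <= k.+1)%N ->
  `|concentration (u k) m%:R - q m| < k.+1%:R^-1.
Hypothesis q_le : forall m, q m <= alpha.
Hypothesis q_gt : forall e : R, 0 < e -> exists m, alpha - e < q m.

Let m_u k : measurable_fun setT (u k).
Proof. by have /HsP[] := Hu k. Qed.

Let fu k : (\int[mu]_x (`|u k x| ^+ 2)%:E < +oo)%E.
Proof. by have /HsP[] := Hu k. Qed.

(** One half of e pays for q m < alpha, the other for the convergence to q m. Monotonicity in the
    radius gives every r >= m, which leaves room to enlarge r for other purposes. *)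
Lemma concentrated_center (e : R) : 0 < e -> exists m, forall r : R, m%:R <= r ->
  exists y : nat -> 'rV[R]_N,
    \forall k \near \oo, alpha - e < mass (u k) (eball (y k) r).
Proof.
move=> e0; have e20 : 0 < e / 2 by lra.
have [m qm] := q_gt e20; exists m => r mr.
(* The center 0 is a default for those k whose concentration is still too small. *)
have /choice[y yP] : forall k, exists y : 'rV[R]_N,
    alpha - e < concentration (u k) r -> alpha - e < mass (u k) (eball y r).
  move=> k; have [/(lt_concentration (m_u k) (fu k))[y ?]|] :=
    ltP (alpha - e) (concentration (u k) r); first by exists y.
  by exists 0.
exists y; near=> k; apply: yP.
apply: lt_le_trans (le_concentration (m_u k) (fu k) mr).
have mk : (m <= k.+1)%N by apply: leqW; near: k; exact: nbhs_infty_ge.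
have := conc_q mk; rewrite ltr_norml => /andP[h _].
have ke : k.+1%:R^-1 < e / 2 by near: k; exact: near_invS.
have : - (e / 2) < concentration (u k) m%:R - q m.
  by apply: lt_trans h; rewrite ltrN2.
move: qm; set c := concentration _ _; set a := q m; lra.
Unshelve. all: by end_near.
Qed.

Lemma dichotomy_of_concentration : 0 < alpha < lambda -> dichotomy s u lambda.
Proof.
move=> alphaP; exists alpha => //; exists id; first exact: cvg_at_right_filter.
move=> eps eps0; have [a0 al] := andP alphaP.
(* 3 e <= eps controls both masses and 3 e <= eps^2 the squared norm of the remainder, so that
   [delta] can be the identity. *)
pose e := Num.min (eps / 3) (eps ^+ 2 / 3).
have e0 : 0 < e by rewrite lt_min !divr_gt0// exprn_gt0.
have e1 : 3 * e <= eps by rewrite mulrC -ler_pdivlMr// ge_min lexx.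
have e2 : 3 * e <= eps ^+ 2 by rewrite mulrC -ler_pdivlMr// ge_min lexx orbT.
have M0 : 0 <= M by rewrite -lee_fin (le_trans _ (gM 0))// gagliardo2_ge0.
have [C C0 cutC] := @gagliardo2_cutoff R N s s01.
(* Chosen so that eta [u]^2 costs at most one eps; the 1 keeps the denominator positive if M = 0. *)
pose eta := eps / (M + 1).
have eta0 : 0 < eta by rewrite divr_gt0//; lra.
have etaM : eta * M <= eps.
  rewrite /eta mulrAC ler_pdivrMr; last lra.
  by rewrite ler_pM2l//; lra.
have e20 : 0 < 2 * e by lra.
have [m center] := concentrated_center e20.
have D0 : 0 <= (1 + eta^-1) * C * (lambda + e).
  rewrite mulr_ge0 ?mulr_ge0 ?addr_ge0 ?invr_ge0 ?(ltW eta0) ?(ltW e0)//; lra.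
(* Chosen after eta, this radius is large enough both for concentration and for the kernel error to
   cost at most another eps. *)
have [r1 [r10 mr1 Dr1]] : exists r1 : R, [/\ 0 < r1, m%:R <= r1 &
    (1 + eta^-1) * C * (lambda + e) * r1 `^ (- (2 * s)) <= eps].
  apply: powR_decay => //; by case/andP: s01 => ? _; lra.
have [y yP] := center r1 mr1.
(* The outer ball has radius 2 r2 = k + 1, the largest radius at which [conc_q] controls the k-th
   term. *)
pose r2 (k : nat) : R := k.+1%:R / 2.
have r20 k : 0 < r2 k by rewrite divr_gt0.
pose v k x := radial_cutoff (y k) r1 x * u k x.
pose w k x := (1 - radial_cutoff (y k) (r2 k) x) * u k x.
have cutL (r : R) (y0 : 'rV[R]_N) : 0 < r -> forall x z, 
    `|(1 - radial_cutoff y0 r x) - (1 - radial_cutoff y0 r z)| <=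
    Num.min 1 (enorm (x - z) / r).
  move=> r0 x z; apply: le_trans (radial_cutoff_lipschitz y0 x z r0).
  by rewrite distrC (_ : _ - _ = radial_cutoff y0 r x - radial_cutoff y0 r z)//; ring.
have Hv k : Hs s (v k).
  apply: (Hs_cutoff s01 r10 (Hu k)).
  - exact: measurable_radial_cutoff.
  - by move=> x; have := radial_cutoff_ge0_le1 (y k) r1 x; rewrite ler_norml; lra.
  - by move=> x z; exact: radial_cutoff_lipschitz.
have Hw k : Hs s (w k).
  apply: (Hs_cutoff s01 (r20 k) (Hu k)).
  - by have [] := weight_radial_cutoffC (y k) (r2 k).
  - by move=> x; have := radial_cutoff_ge0_le1 (y k) (r2 k) x; rewrite ler_norml; lra.
  - exact: cutL.
have : \forall k \near \oo, [/\ alpha - 2 * e < mass (u k) (eball (y k) r1),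
    `|lambda - total (u k)| < e, k.+1%:R^-1 < e & 4 * r1 <= k.+1%:R].
  near=> k; split.
  - by near: k.
  - by near: k; apply: cvgr_dist_lt.
  - by near: k; exact: near_invS.
  - near: k; have [n _ nP] := nbhs_infty_ger (4 * r1); exists n => // k /nP/= h.
    by apply: (le_trans h); rewrite ler_nat.
move=> [k0 _ k0P]; exists k0, v, w; split => [k| |k k0k]; first by split.
  apply/cvgeyPge => A; near=> k.
  apply: (@le_trans _ _ (r2 k - 2 * r1)%:E); last exact: set_dist_cutoff.
  rewrite lee_fin lerBrDr /r2 ler_pdivlMr//.
  near: k; have [n _ nP] := nbhs_infty_ger ((A + 2 * r1) * 2); exists n => // k /nP/= h.
  by apply: (le_trans h); rewrite ler_nat.
have [center_k total_k invk rk] := k0P k k0k.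
have r12 : 2 * r1 <= r2 k by rewrite /r2 ler_pdivlMr//; lra.
have r22 : 2 * r2 k = k.+1%:R by rewrite /r2; field.
have conc_k : mass (u k) (eball (y k) (2 * r2 k)) <= alpha + e.
  apply: (le_trans (mass_eball_le_concentration (m_u k) (fu k) _ _)).
  rewrite r22; have := conc_q (leqnn k.+1); rewrite ltr_norml => /andP[_].
  move: (q_le k.+1) invk; set c := concentration _ _; set a := q _.
  by set t := _^-1; lra.
have total_lt : lambda - e < total (u k) < lambda + e.
  by rewrite -ltr_distlC.
split.
- apply: Lnorm2_le; first exact: ltW.
  apply: (le_trans (integral_splitting_remainder (y k) r10 r12 (m_u k) (fu k))).
  by rewrite lee_fin; lra.
- rewrite integral_mul_sqr_wmass//; last exact: weight_radial_cutoff.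
  rewrite -EFinB lee_fin ler_norml.
  by have := wmass_inner_cutoff (y k) r10 r12 (m_u k) (fu k); lra.
- rewrite integral_mul_sqr_wmass//; last exact: weight_radial_cutoffC.
  rewrite -EFinB lee_fin ler_norml.
  by have := wmass_outer_cutoff (y k) r10 r12 (m_u k) (fu k); lra.
have gfin (f : 'rV[R]_N -> R) : Hs s f -> gagliardo2 s f = (fine (gagliardo2 s f))%:E.
  by move=> /HsP[_ _ ?]; rewrite fineK// ge0_fin_numE// gagliardo2_ge0.
have := @cutC (u k) (radial_cutoff (y k) r1)
  (fun x => 1 - radial_cutoff (y k) (r2 k) x) r1 eta (m_u k)
  (measurable_radial_cutoff _ _) (proj1 (weight_radial_cutoffC _ _)) r10 eta0.
move=> /(_ (sqr_radial_cutoff_le (y k) r10 r12)).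
move=> /(_ (fun x z => radial_cutoff_lipschitz (y k) x z r10)).
(* The outer cutoff varies at scale r2 >= r1, hence also satisfies the bound at scale r1. *)
have psiL x z : `|(1 - radial_cutoff (y k) (r2 k) x) - (1 - radial_cutoff (y k) (r2 k) z)|
    <= Num.min 1 (enorm (x - z) / r1).
  apply: (le_trans (cutL _ _ (r20 k) x z)).
  rewrite le_min ge_min lexx/= ge_min; apply/orP; right.
  rewrite ler_wpM2l ?enorm_ge0// lef_pV2 ?posrE//; lra.
move=> /(_ psiL); rewrite -/(v k) -/(w k).
rewrite (gfin _ (Hu k)) (gfin _ (Hv k)) (gfin _ (Hw k)) integral_sqr_wmass//.
have gk : fine (gagliardo2 s (u k)) <= M by rewrite -lee_fin -gfin.
rewrite -!EFinM -!EFinB -!EFinD !lee_fin.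
move: gk; set gu := fine _; set gv := fine _; set gw := fine _ => gk cut.
(* This error and eta [u]^2 are at most eps each, whence the loss of 2 eps. *)
have : (1 + eta^-1) * (C * r1 `^ (- (2 * s))) * total (u k) <= eps.
  apply: le_trans Dr1; rewrite [leRHS]mulrAC !mulrA.
  rewrite ler_wpM2l ?mulr_ge0 ?powR_ge0 ?addr_ge0 ?invr_ge0 ?(ltW eta0)//.
  by case/andP: total_lt => _ /ltW.
have : eta * gu <= eps by apply: le_trans etaM; rewrite ler_wpM2l// ltW.
lra.
Unshelve. all: by end_near.
Qed.

(** For a natural n >= r, the concentration at r is at most that at n, which is below q n + 1/(k +
    1) <= 1/(k + 1). *)
Lemma vanishing_of_concentration : alpha = 0 -> vanishing u.
Proof.
move=> alpha0 r r0.
under eq_cvg do rewrite (concentrationE (m_u _) (fu _)).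
apply: cvg_EFin; first exact: nearW.
have [n _ nP] := nbhs_infty_ger r.
apply/cvgrPdist_lt => e e0; near=> k => /=.
rewrite sub0r normrN ger0_norm; last exact: concentration_ge0.
apply: (@le_lt_trans _ _ (concentration (u k) n%:R)).
  by apply: le_concentration => //; exact: nP (leqnn n).
have nk : (n <= k.+1)%N by apply: leqW; near: k; exact: nbhs_infty_ge.
have := conc_q nk; rewrite ltr_norml => /andP[_].
have : k.+1%:R^-1 < e by near: k; exact: near_invS.
move: (q_le n); rewrite alpha0; set c := concentration _ _; set a := q _.
by set t := _^-1; lra.
Unshelve. all: by end_near.
Qed.

Lemma mass_disjointD k (A B : set 'rV[R]_N) : measurable A -> measurable B ->
  A `&` B = set0 -> mass (u k) A + mass (u k) B <= total (u k).
Proof.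
move=> mA mB AB; apply: wmassD_le => //; try exact: weight_indic.
  exact: weight1.
move=> x; rewrite !indicE /=.
have [xA|_] := boolP (x \in A); have [xB|_] := boolP (x \in B);
  rewrite ?addr0 ?add0r ?ler01//.
have : (A `&` B) x by split; exact: set_mem.
by rewrite AB.
Qed.

(** The centers y must not depend on eps, so they are fixed first by capturing more than half of
    lambda. A ball around z carrying almost all the mass must then meet the ball around y. *)
Lemma compactness_of_concentration : alpha = lambda -> 0 < lambda ->
  compactness u lambda.
Proof.
move=> al l0; have l20 : 0 < lambda / 2 by lra.
have [m0 cen0] := concentrated_center l20.
(* The maximum with 1 keeps the final radius positive. *)
pose r0 : R := Num.max m0%:R 1.
have r01 : 1 <= r0 by rewrite le_max lexx orbT.
have [|y yP] := cen0 r0; first by rewrite le_max lexx.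
(* With e <= lambda/4, disjoint balls would carry more than lambda/2 + 3 lambda/4, while the total
   is eventually below 5 lambda/4. *)
exists y => eps eps0; pose e := Num.min eps (lambda / 4).
have e0 : 0 < e by rewrite lt_min eps0/=; lra.
have [m cen] := concentrated_center e0.
have [z zP] := cen m%:R (lexx _).
have m_ge0 : 0 <= m%:R :> R by [].
have l40 : 0 < lambda / 4 by lra.
(* The centers are less than r0 + m apart, and the ball around z adds another m. *)
exists (r0 + 2 * m%:R); first by lra.
near=> k.
rewrite integral_in_sqr_wmass//; last exact: measurable_eball.
have [e_eps e_l] : e <= eps /\ e <= lambda / 4.
  by rewrite /e !ge_min !lexx orbT.
have zk : alpha - e < mass (u k) (eball (z k) m%:R) by near: k.
have yk : alpha - lambda / 2 < mass (u k) (eball (y k) r0) by near: k.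
have tk : `|lambda - total (u k)| < lambda / 4.
  by near: k; apply: cvgr_dist_lt.
have [AB|/set0P[x [xy xz]]] := eqVneq (eball (y k) r0 `&` eball (z k) m%:R) set0.
  exfalso; have := mass_disjointD k (measurable_eball _ _) (measurable_eball _ _) AB.
  by move: tk yk zk; rewrite ltr_norml; lra.
rewrite lee_fin; apply: (@le_trans _ _ (mass (u k) (eball (z k) m%:R))); first by lra.
apply: wmass_indic_subset => //; [exact: measurable_eball..|].
apply: eball_subset.
have : enorm (z k - y k) <= enorm (z k - x) + enorm (x - y k).
  by apply: le_trans (ler_enormD _ _); rewrite addrA subrK.
move: xy xz; rewrite /eball/= (enorm_distC (z k) x); lra.
Unshelve. all: by end_near.
Qed.

End cases.

(* Along a free ultrafilter every bounded sequence converges, so all the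
   sequences [a ^~ m] converge at once and a single choice gives phi. *)
Lemma common_subsequence (R : realType) (a : nat -> nat -> R) (B : R) :
  (\forall k \near \oo, forall m, 0 <= a k m <= B) ->
  exists (phi : nat -> nat) (q : nat -> R),
    [/\ {homo phi : m n / (m < n)%N}, forall m, 0 <= q m <= B &
        forall j m, (m <= j.+1)%N -> `|a (phi j) m - q m| < j.+1%:R^-1].
Proof.
move=> aB; have [F [UF ooF]] := @ultraFilterLemma nat \oo _.
have /choice[q qP] : forall m, exists l : R,
    0 <= l <= B /\ forall e, 0 < e -> \forall k \near F, `|a k m - l| < e.
  move=> m.
  have aF : (a k m @[k --> F]) `[0, B]%classic.
    by apply: ooF; near=> k; rewrite /= in_itv/=; move: m; near: k.
  have [l [l0B cl]] := segment_compact _ aF.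
  exists l; split; first by move: l0B; rewrite /= in_itv.
  move=> e e0.
  under eq_near do rewrite distrC.
  (* Along an ultrafilter a cluster point is a limit: otherwise the complement of the ball would
     have its preimage in F. *)
  have [//|nF] := in_ultra_setVsetC ((a^~ m) @^-1` ball l e) UF.
  have [t [nt lt]] := cl (~` ball l e) (ball l e) nF (nbhsx_ballx l e e0).
  by [].
have next (j n : nat) : exists k, (n < k)%N /\
    forall m, (m <= j.+1)%N -> `|a k m - q m| < j.+1%:R^-1.
  (* Only the finitely many m <= j + 1 are constrained at stage j; the ordinal type makes this
     finiteness usable. *)
  have : \forall k \near F, (n < k)%N /\
      forall m : 'I_j.+2, `|a k m - q m| < j.+1%:R^-1.
    apply: filterI; first by apply: ooF; exact: nbhs_infty_gt.
    by apply: filter_forall => m; apply: (qP m).2.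
  move=> /filter_ex[k [nk km]]; exists k; split => // m mj.
  exact: (km (Ordinal (mj : (m < j.+2)%N))).
pose c j := projT1 (choice (next j)).
have cP j : forall n, (n < c j n)%N /\
    forall m, (m <= j.+1)%N -> `|a (c j n) m - q m| < j.+1%:R^-1.
  exact: projT2 (choice (next j)).
(* Each index is chosen beyond the previous one, with the accuracy of its own stage. *)
pose phi := fix phi j := if j is j'.+1 then c j (phi j') else c 0%N 0%N.
exists phi, q; split => [|m|j m mj]; last 2 first.
- exact: (qP m).1.
- by case: j mj => [|j] mj; apply: (cP _ _).2.
apply: homo_ltn => [y x z|j]; first exact: ltn_trans.
exact: (cP j.+1 (phi j)).1.
Unshelve. all: by end_near.
Qed.

(** * Assembly: the value of [alpha] selects the case *)

Theorem theorem1p1 (R : realType) (N : nat) (s lambda : R)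
    (u : nat -> 'rV[R]_N -> R) :
  (1 <= N)%N -> 0 < s < 1 ->
  (forall n, Hs s (u n)) ->
  (exists M : R, forall n, (Hs_norm s (u n) <= M%:E)%E) ->
  (\int[lebesgue_rV R N]_x (`|u n x| ^+ 2)%:E)%E @[n --> \oo] --> lambda%:E ->
  exists2 phi : nat -> nat, {homo phi : m n / (m < n)%N} &
    [\/ compactness (u \o phi) lambda,
        vanishing (u \o phi) |
        dichotomy s (u \o phi) lambda].
Proof.
move=> _ s01 Hu [M uM] cvg_int.
have m_u n : measurable_fun setT (u n) by have /HsP[] := Hu n.
have fu n : (\int[lebesgue_rV R N]_x (`|u n x| ^+ 2)%:E < +oo)%E.
  by have /HsP[] := Hu n.
have cvg_total : wmass (lebesgue_rV R N) (u n) (cst 1) @[n --> \oo] --> lambda.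
  apply: cvg_trans (fine_cvg cvg_int); apply: near_eq_cvg; apply: nearW => n.
  by rewrite /= integral_sqr_wmass.
have conc_bnd : \forall k \near \oo, forall m : nat,
    0 <= concentration (u k) m%:R <= lambda + 1.
  near=> k => m; rewrite concentration_ge0//=.
  apply: le_trans (concentration_le_total (m_u k) (fu k) _) _.
  have : `|lambda - wmass (lebesgue_rV R N) (u k) (cst 1)| < 1.
    by near: k; apply: cvgr_dist_lt.
  by rewrite ltr_norml; lra.
have [phi [q [phi_incr q_bnd conc_q]]] := common_subsequence conc_bnd.
exists phi => //.
have phi_cvg : phi n @[n --> \oo] --> \oo.
  have phi_ge n : (n <= phi n)%N.
    by elim: n => // n ih; exact: leq_ltn_trans ih (phi_incr _ _ (ltnSn n)).
  apply/cvgnyPge => A; near=> n; apply: leq_trans (phi_ge n).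
  by near: n; exact: nbhs_infty_ge.
have cvg_total_phi :
    wmass (lebesgue_rV R N) (u (phi n)) (cst 1) @[n --> \oo] --> lambda.
  exact: cvg_comp phi_cvg cvg_total.
have gM k : (gagliardo2 s (u (phi k)) <= (M ^+ 2)%:E)%E.
  exact: gagliardo2_le_Hs_norm.
have ubq : has_ubound (range q).
  by exists (lambda + 1) => _ [m _ <-]; have /andP[] := q_bnd m.
pose alpha := sup (range q).
have q_le m : q m <= alpha by apply: ub_le_sup => //; exists m.
have q_gt e : 0 < e -> exists m, alpha - e < q m.
  by move=> e0; have [|_ [m _ <-] ?] := sup_adherent e0 (E := range q);
    [split => //; exists (q 0%N), 0%N|exists m].
have alpha_ge0 : 0 <= alpha by apply: le_trans (q_le 0%N); have /andP[] := q_bnd 0%N.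
(* Each q m is a limit of concentrations bounded by total masses, and these tend to lambda. *)
have alpha_le : alpha <= lambda.
  apply: ge_sup; first by exists (q 0%N), 0%N.
  move=> _ [m _ <-]; apply/ler_addgt0Pr => e e0.
  have e20 : 0 < e / 2 by lra.
  near \oo => k.
  have mk : (m <= k.+1)%N by apply: leqW; near: k; exact: nbhs_infty_ge.
  have := conc_q _ _ mk; rewrite ltr_norml => /andP[h _].
  have ke : k.+1%:R^-1 < e / 2 by near: k; exact: near_invS.
  have := concentration_le_total (m_u (phi k)) (fu (phi k)) m%:R.
  have : `|lambda - wmass (lebesgue_rV R N) (u (phi k)) (cst 1)| < e / 2.
    by near: k; apply: cvgr_dist_lt.
  move: h ke; rewrite ltr_norml; set c := concentration _ _; set a := q _.
  by set t := _^-1; set b := wmass _ _ _; lra.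
(* Testing alpha = 0 first disposes of lambda = 0 and leaves lambda > 0 for compactness. *)
have [alpha0|alphaN0] := eqVneq alpha 0.
  by constructor 2; exact: (vanishing_of_concentration (s := s) _ conc_q q_le).
have alpha_gt0 : 0 < alpha by rewrite lt_def alphaN0.
have [alphaE|alphaNE] := eqVneq alpha lambda.
  constructor 1; apply: (compactness_of_concentration (s := s) (alpha := alpha) _ _ conc_q) => //.
  by rewrite -alphaE.
constructor 3; apply: (dichotomy_of_concentration s01 _ gM _ conc_q q_le) => //.
by rewrite alpha_gt0 lt_def eq_sym alphaNE.
Unshelve. all: by end_near.
Qed.
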